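(* There exist universal constants $c>0$ and $c_0>0$ such that the following holds. Let $n\in\mathbb{N}$, let $0<\tau_1\le\dots\le\tau_n$ be the computation times of the workers in the fixed computation model, and let $e_1,\dots,e_n$ be the standard basis of $\mathbb{R}^n$. Let $R,\mu,\beta,\sigma,\varepsilon>0$ satisfy $$0<\varepsilon\le \frac{c\,\beta^2}{\mu^2 n^2}\qquad\text{and}\qquad R^2\ge \frac{\beta^2}{\mu^2 n}.$$ Consider any randomized method that starts at $x^0=0\in\mathbb{R}^n$ and accesses the functions $f_1,\dots,f_n$ only through stochastic gradients of the form $\nabla f_i(x;\xi_i)=\nabla f_i(x)+\xi_i e_i$ with $\xi_i\sim\mathcal{N}(0,\sigma^2)$, $i\in[n]$, $x\in\mathbb{R}^n$. Then for any time budget $$t\le c_0\left(\frac1n\sum_{i=1}^n\tau_i\right)\frac{\sigma^2}{n\mu^2\varepsilon}$$ there exist $\varphi_1,\dots,\varphi_n\in[-1,1]$ such that, for the functions $f_i:\mathbb{R}^n\to\mathbb{R}$, $$f_i(x)=\frac{\mu}{2}\|x\|^2-\beta\varphi_i\langle x,e_i\rangle,\qquad f=\frac1n\sum_{i=1}^n f_i,$$ the following hold: (1) $f$ and all the $f_i$ are differentiable and smooth (have Lipschitz gradients), all the $f_i$ are convex and $f$ attains its minimum, the stochastic gradients are unbiased with variance bounded by $\sigma^2$, and $f$ satisfies the Polyak-Łojasiewicz condition with parameter $\mu$; (2) $\max_{i,j\in[n]}\|\nabla f_i(x)-\nabla f_j(x)\|^2\le\delta_1$ for all $x\in\mathbb{R}^n$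 with $\delta_1=2\beta^2$; (3) $\max_{i,j\in[n]}\|\nabla^2 f_i(x)-\nabla^2 f_j(x)\|^2\le\delta_2$ for all $x\in\mathbb{R}^n$ with $\delta_2=0$; (4) $\|x^0-x^*\|^2\le R^2$, where $x^*$ is the minimizer of $f$; (5) the method cannot produce a (random) point $\bar x$ with $\mathbb{E}\left[\|\bar x-x^*\|^2\right]\le\varepsilon$ within $t$ seconds.
   Context: $[n]=\{1,\dots,n\}$; $\|\cdot\|$ is the Euclidean norm (operator norm for matrices). Distributed setting: there are $n$ workers operating in parallel and asynchronously; worker $i$ has access only to stochastic gradients $\nabla f_i(x;\xi_i)$ of $f_i$, each returned stochastic gradient using a fresh independent sample $\xi_i$. Fixed computation model: worker $i$ computes one stochastic gradient at a time and each computation takes $\tau_i$ seconds, so by time $t$ worker $i$ has returned at most $\lfloor t/\tau_i\rfloor$ stochastic gradients. Randomized method: any procedure that, using its own internal randomness (independent of the gradient noise) and the stochastic gradients returned so far, adaptively decides at which points the workers compute stochastic gradients, and which outputs (random) points depending only on this information. A point is produced within $t$ seconds if it depends only on the internal randomness and on stochastic gradients returned by time $t$. Unbiased, $\sigma^2$-variance-bounded: $\mathbb{E}_{\xi_i}[\nabla f_i(x;\xi_i)]=\nabla f_i(x)$ and $\mathbb{E}_{\xi_i}[\|\nabla f_i(x;\xi_i)-\nabla f_i(x)\|^2]\le\sigma^2$ for all $x$ and $i$. Polyak-Łojasiewicz condition with parameter $\mu>0$: $\|\nabla f(x)\|^2\ge 2\mu(f(x)-f^* )$ for all $x$, where $f^*$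 is the finite optimal value of $f$. *)

(* Defs.v *)
From HB Require Import structures.
From mathcomp Require Import all_boot all_order all_algebra.
From mathcomp Require Import all_classical all_reals all_analysis.
From mathcomp Require Import lra.
Import Order.TTheory GRing.Theory Num.Theory.
Import numFieldNormedType.Exports.

Set Implicit Arguments.
Unset Strict Implicit.
Unset Printing Implicit Defensive.

Local Open Scope classical_set_scope.
Local Open Scope ring_scope.

Section Euclidean.
Context {R : realType} {n : nat}.
Implicit Types (x y v : 'rV[R]_n) (f : 'rV[R]_n -> R).

Definition dot x y : R := \sum_(j < n) x 0 j * y 0 j.

(* The library norm of a matrix is the maximum of the absolute values of its
   entries, hence these separate Euclidean and operator norms. *)
Definition enorm x : R := Num.sqrt (dot x x).

Definition opnorm (A : 'M[R]_n) : R :=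
  sup [set enorm (v *m A) | v in [set v | enorm v <= 1]].

Definition basis_vec (i : 'I_n) : 'rV[R]_n := delta_mx 0 i.

Definition gradient f x : 'rV[R]_n := \row_j 'D_(basis_vec j) f x.

Definition hessian f x : 'M[R]_n := jacobian (gradient f) x.

Definition smooth f : Prop :=
  (forall x, differentiable f x) /\
  exists L : R, forall x y,
    enorm (gradient f x - gradient f y) <= L * enorm (x - y).

Definition is_minimizer f x : Prop := forall y, f x <= f y.

Definition polyak_lojasiewicz (mu : R) f : Prop :=
  has_inf (range f) /\
  forall x, 2 * mu * (f x - inf (range f)) <= enorm (gradient f x) ^+ 2.

Definition convex f : Prop := @convex_function R 'rV[R]_n setT f.

End Euclidean.

(* The computation model.  What a method has observed is recorded in a log:
   the pairs (worker, returned stochastic gradient), most recent first.  The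
   return times are not recorded because they are determined by the internal
   randomness and the log, see [status_of]. *)
Section Method.
Context {R : realType} {n : nat}.

Definition log := seq ('I_n * 'rV[R]_n).

Definition log_of (w : seq 'I_n) (y : (size w).-tuple (n.-tuple R)) : log :=
  zip w [seq \row_j tnth v j | v <- y].

Definition log_measurable d (U : measurableType d) d' (T : measurableType d')
    (F : U -> log -> T) : Prop :=
  forall w : seq 'I_n, measurable_fun setT
    (fun p : U * (size w).-tuple (n.-tuple R) => F p.1 (log_of p.2)).

(* [U] is the space of the internal randomness.  At time 0 and after every
   returned gradient the method gives orders, knowing the log [h].  If
   [launch u h i], worker [i] drops what it is doing and starts computing a
   stochastic gradient at [query u h i] after waiting [delay u h i] seconds,
   unless some gradient is returned in the meantime, in which case new orders
   are given.  Otherwise worker [i] carries on (or stays idle).  No information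
   arrives between two returns, so nothing is gained by deciding more often.
   [output t u h] is the point output at time [t], [h] being the log of the
   gradients returned by time [t]. *)
Record method d (U : measurableType d) := Method {
  launch : U -> log -> 'I_n -> bool;
  delay : U -> log -> 'I_n -> R;
  query : U -> log -> 'I_n -> 'rV[R]_n;
  output : R -> U -> log -> 'rV[R]_n;
  delay_ge0 : forall u h i, 0 <= delay u h i;
  measurable_launch : forall i, log_measurable (fun u h => launch u h i);
  measurable_delay : forall i, log_measurable (fun u h => delay u h i);
  measurable_query : forall i j, log_measurable (fun u h => query u h i 0 j);
  measurable_output :
    forall t j, log_measurable (fun u h => output t u h 0 j) }.

(* start time and query point of a computation, [None] for an idle worker *)
Definition jobs := 'I_n -> option (R * 'rV[R]_n).

Record status := Status { clock : R; running : jobs }.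

Section Run.
Context (tau : 'I_n -> R) d (U : measurableType d) (M : method U).

Definition finish (p : jobs) (i : 'I_n) : \bar R :=
  if p i is Some (s, _) then (s + tau i)%:E else +oo%E.

(* Simultaneous returns are handled one after the other at the same clock. *)
Definition next (p : jobs) : option 'I_n :=
  [pick i | (finish p i < +oo)%E && [forall j, (finish p i <= finish p j)%E]].

(* A job due to start at [T] or later has not begun when the gradient returned
   at time [T] arrives, so it is discarded: every computation is started
   knowing all the gradients returned by its start time. *)
Definition advance (p : jobs) (st : status) : status :=
  if next p is Some i then
    let T := fine (finish p i) in
    Status T (fun j => if p j is Some (s, x) then
                         if (j != i) && (s < T) then Some (s, x) else None
                       else None)
  else st.

Definition orders (u : U) (h : log) (st : status) : jobs := fun i =>
  if launch M u h i then Some (clock st + delay M u h i, query M u h i)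
  else running st i.

Fixpoint status_of (u : U) (h : log) : status :=
  if h is _ :: h' then
    let st := status_of u h' in advance (orders u h' st) st
  else Status 0 (fun=> None).

Definition plan (u : U) (h : log) : jobs := orders u h (status_of u h).

Definition nreturned (h : log) (i : 'I_n) : nat := count (fun e => e.1 == i) h.

(* [oracle i x xi] is the stochastic gradient of [f_i] at [x] with sample [xi];
   the k-th gradient returned by worker [i] uses the fresh sample [z i k]. *)
Context (oracle : 'I_n -> 'rV[R]_n -> R -> 'rV[R]_n).
Context (t : R) (u : U) (z : 'I_n -> nat -> R).

(* the next gradient returned after [h], if it is returned by time [t] *)
Definition next_entry (h : log) : option ('I_n * 'rV[R]_n) :=
  if next (plan u h) is Some i then
    if plan u h i is Some (s, x) then
      if s + tau i <= t then Some (i, oracle i x (z i (nreturned h i)))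
      else None
    else None
  else None.

Fixpoint entries (m : nat) : log :=
  if m is m'.+1 then
    let h := entries m' in if next_entry h is Some e then e :: h else h
  else [::].

(* Worker [i] returns at most floor(t / tau i) gradients by time [t], so this
   many steps exhaust the gradients returned by time [t]: [log_by_complete]. *)
Definition log_by : log := entries (\sum_i Num.truncn (t / tau i)).

Definition output_by : 'rV[R]_n := output M t u log_by.

Context (tau_gt0 : forall i, 0 < tau i).

Let within_clock (h : log) : Prop :=
  let st := status_of u h in
  [/\ forall i, (nreturned h i)%:R * tau i <= clock st,
      forall i s x, running st i = Some (s, x) ->
        (nreturned h i)%:R * tau i <= s,
      forall i s x, running st i = Some (s, x) -> clock st <= s + tau i
    & forall i, (nreturned h i <= Num.truncn (t / tau i))%N].

Let within_clock_step (h : log) e :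
  within_clock h -> next_entry h = Some e -> within_clock (e :: h).
Proof.
rewrite /within_clock /= /next_entry -/(plan u h) /advance /next.
set st := status_of u h; move=> [Hc Hs Hr Ht].
case: pickP => [i /andP[_ /forallP imin]|//].
case pi: (plan u h i) => [[s x]|//]; case: ifP => // st_t [<-] /=.
have planP j s' x' : plan u h j = Some (s', x') ->
    (nreturned h j)%:R * tau j <= s' /\ clock st <= s' + tau j.
  rewrite /plan /orders -/st; case: ifP => _; last first.
    by move=> run; split; [exact: Hs run|exact: Hr run].
  move=> [<- _]; have d0 := delay_ge0 M u h j; have t0 := tau_gt0 j.
  by have := Hc j; split; lra.
have [ci_s clock_T] := planP _ _ _ pi.
have finE : finish (plan u h) i = (s + tau i)%:E by rewrite /finish pi.
rewrite finE /=; split.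
- move=> j; case: eqVneq => [<-|_] /=; first by rewrite natrD; lra.
  by rewrite add0n; exact: le_trans (Hc j) clock_T.
- move=> j s' x'; case pj: (plan u h j) => [[s1 x1]|//].
  case: ifP => // /andP[ji _] [<- _]; rewrite eq_sym (negbTE ji) add0n.
  by have [] := planP _ _ _ pj.
- move=> j s' x'; case pj: (plan u h j) => [[s1 x1]|//].
  case: ifP => // _ [<- _]; have := imin j.
  by rewrite finE /finish pj lee_fin.
- move=> j; case: eqVneq => [<-|_] /=; last by rewrite add0n.
  have bnd : (1 + nreturned h i)%:R <= t / tau i.
    by rewrite ler_pdivlMr// natrD; lra.
  by rewrite -(@natrK R (1 + _)) le_truncn.
Qed.

(* [log_by] misses no gradient returned by time [t]. *)
Lemma log_by_complete : next_entry log_by = None.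
Proof.
have inv m : within_clock (entries m).
  elim: m => [|m IH] /=.
    by split=> //= i; rewrite ?mul0r.
  by case E: (next_entry _) => [e|//]; exact: within_clock_step E.
have full m e : next_entry (entries m) = Some e -> size (entries m) = m.
  elim: m e => [//|m IH] e /=; case E: (next_entry (entries m)) => [e'|].
    by move=> _ /=; rewrite (IH _ E).
  by rewrite E.
have sumE h : (\sum_i nreturned h i)%N = size h.
  elim: h => [|[j g] h IH] /=; first by rewrite big1.
  rewrite big_split/= IH (bigD1 j)//= eqxx big1 ?addn0// => i ij.
  by rewrite eq_sym (negbTE ij).
rewrite /log_by; set N := (\sum_i _)%N.
case E: (next_entry _) => [e|//]; exfalso.
have [_ _ _ Ht] := inv N.+1; move: Ht; rewrite /= E => Ht.
have : (size (e :: entries N) <= N)%N.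
  by rewrite -sumE; apply: leq_sum => i _; exact: Ht.
by rewrite /= (full _ _ E) ltnn.
Qed.

End Run.
End Method.
Arguments log : clear implicits.
Arguments method R n {d} U.

Section Noise.
Context {R : realType} {n : nat}.
Context {d : measure_display} {Omega : measurableType d} (P : probability Omega R).

(* Mutual independence of [seed] and all the [noise i k]: setting some of the
   sets to [setT] yields the product rule for every finite subfamily. *)
Definition independent_samples d' (U : measurableType d')
    (seed : {RV P >-> U}) (noise : 'I_n -> nat -> {RV P >-> R}) : Prop :=
  forall (A : set U) (K : nat) (B : 'I_n -> nat -> set R),
    measurable A -> (forall i k, measurable (B i k)) ->
    P (seed @^-1` A `&`
       [set w | forall i k, (k < K)%N -> B i k (noise i k w)]) =
    (P (seed @^-1` A) *
     \prod_(i < n) \prod_(k < K) P (noise i k @^-1` B i k))%E.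

Definition normal_noise (sigma : R) (noise : 'I_n -> nat -> {RV P >-> R}) :=
  forall i k (B : set R), measurable B ->
    distribution P (noise i k) B = normal_prob 0 sigma B.

End Noise.

Section Instance.
Context {R : realType} {n : nat}.

Definition worker_fun (mu beta : R) (phi : 'I_n -> R) (i : 'I_n)
    (x : 'rV[R]_n) : R :=
  mu / 2 * enorm x ^+ 2 - beta * phi i * dot x (basis_vec i).

Definition average (f : 'I_n -> 'rV[R]_n -> R) (x : 'rV[R]_n) : R :=
  n%:R^-1 * \sum_(i < n) f i x.

Definition stoch_grad (f : 'I_n -> 'rV[R]_n -> R) (i : 'I_n) (x : 'rV[R]_n)
    (xi : R) : 'rV[R]_n :=
  gradient (f i) x + xi *: basis_vec i.

(* unbiasedness is stated coordinatewise *)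
Definition unbiased_variance_bounded d (Omega : measurableType d)
    (P : probability Omega R) (f : 'I_n -> 'rV[R]_n -> R) (sigma : R)
    (noise : 'I_n -> nat -> {RV P >-> R}) : Prop :=
  forall i k x,
    (forall j : 'I_n,
      'E_P[(fun w => stoch_grad f i x (noise i k w) 0 j)%R] =
      (gradient (f i) x 0 j)%:E)%E /\
    ('E_P[(fun w => enorm (stoch_grad f i x (noise i k w) - gradient (f i) x)
                    ^+ 2)%R] <= (sigma ^+ 2)%:E)%E.

End Instance.

(* Main.v *)
(* The stochastic gradient of f_i at x is mu x + (xi - beta phi_i) e_i, so the
   output at time t is a function of the seed and of the shifted samples
   xi_ik - beta phi_i with k < N_i, where N_i <= t / tau_i bounds the number of
   gradients worker i can return; adaptivity plays no further role.  Taking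
   phi_i = +s_i or -s_i, the two laws that differ in the sign of phi_i have
   likelihood ratios p, q with respect to the unshifted noise satisfying
   E[1/p] = E[1/q] = exp (N_i beta^2 s_i^2 / sigma^2) <= 3/2 as soon as
   s_i^2 = min(1, sigma^2 tau_i / (3 beta^2 t)).  Coordinate i of the minimizer
   is +a_i or -a_i with a_i = beta s_i / (n mu), and the two mean square errors
   there add up to at least a_i^2.  Averaging over all sign vectors (Assouad),
   one of them has risk at least (1/2) sum_i a_i^2 > eps. *)
Require Import Defs.
From mathcomp Require Import all_boot all_order all_algebra.
From mathcomp Require Import all_classical all_reals all_analysis.
From mathcomp Require Import measurable_realfun ring lra.
Import Order.TTheory GRing.Theory Num.Theory.
Import numFieldNormedType.Exports.
Set Implicit Arguments.
Unset Strict Implicit.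
Unset Printing Implicit Defensive.
Local Open Scope classical_set_scope.
Local Open Scope ring_scope.

(** * Gaussian shifts and moments *)

Section Gaussian.
Context {R : realType}.
Local Open Scope ereal_scope.
Local Notation mu := (@lebesgue_measure R).

(** With the signs moved into the shifts, the method is one fixed function of seed and samples, and
    the obstacle is to integrate it. Independence is given only through product rules for finitely
    many samples, so laws are compared on the space [paths], generated by boxes with finitely many
    constraints. The log has random length and random workers, so measurability of the output is
    checked on the countably many fibers where this discrete data is constant. Both shifted laws are
    compared with the unshifted noise rather than with each other. A pointwise AM-GM inequality then
    leaves only the mean of the inverse likelihood ratio, and this inverse is a constant times the
    likelihood ratio of the opposite shift, so its mean is exact. This comparison uses integrals of
    nonnegative extended reals, so infinite risks are covered. *)

Lemma lebesgue_measure_addr (s : R) (A : set R) : measurable A ->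
  pushforward mu (fun x : measurableTypeR R => (x + s)%R : measurableTypeR R) A = mu A.
Proof.
pose shift : measurableTypeR R -> measurableTypeR R := fun x => (x + s)%R.
have mshift : measurable_fun setT shift by exact: measurable_funD.
move=> mA; apply/esym/lebesgue_measure_unique => //= _ [[a b]] _ <-.
rewrite /pushforward /=.
have -> : (fun x : measurableTypeR R => (x + s)%R) @^-1` `]a, b] = `](a - s)%R, (b - s)%R]%classic.
  by apply/seteqP; split=> x /=; rewrite !in_itv/= ltrBlDr lerBrDr.
rewrite !lebesgue_measure_itv/= !lte_fin ltrD2r.
by case: ifP => // _; rewrite -!EFinB; congr (_%:E); lra.
Qed.

Lemma ge0_integral_addr (s : R) (f : R -> \bar R) :
  measurable_fun setT f -> (forall x, 0 <= f x) ->
  \int[mu]_x f (x + s)%R = \int[mu]_x f x.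
Proof.
move=> mf f0.
have ms : measurable_fun setT (fun x : measurableTypeR R => (x + s)%R : measurableTypeR R).
  exact: measurable_funD.
rewrite -[LHS](@ge0_integral_pushforward _ _ _ _ _ _ ms mu setT f)//.
by apply: eq_measure_integral => //= A mA _; exact: lebesgue_measure_addr.
Qed.

(** The change of variables comes with the Radon-Nikodym derivative, which has the same integral as
    [normal_pdf] over every measurable set and so agrees with it almost everywhere. *)
Lemma ge0_integral_normal_prob (m s : R) (f : R -> \bar R) :
  measurable_fun setT f -> (forall x, 0 <= f x) ->
  \int[normal_prob m s]_x f x = \int[mu]_x (f x * (normal_pdf m s x)%:E).
Proof.
move=> mf f0; have dom := @normal_prob_dominates R m s.
rewrite -(Radon_Nikodym_SigmaFinite.change_of_variables dom)//.
apply: ge0_ae_eq_integral => //.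
- apply: emeasurable_funM => //.
  exact: measurable_int (Radon_Nikodym_SigmaFinite.f_integrable dom).
- apply: emeasurable_funM => //; apply/measurable_EFinP.
  exact: measurable_normal_pdf.
- by move=> x _; rewrite mule_ge0// Radon_Nikodym_SigmaFinite.f_ge0.
- by move=> x _; rewrite mule_ge0// lee_fin normal_pdf_ge0.
apply: ae_eqe_mul2l; apply: integral_ae_eq => //.
- exact: Radon_Nikodym_SigmaFinite.f_integrable.
- by apply/measurable_EFinP; exact: measurable_normal_pdf.
- by move=> A _ mA; rewrite -Radon_Nikodym_SigmaFinite.f_integral.
Qed.

(* The density of N(s, sigma ^ 2) with respect to N(0, sigma ^ 2). *)
Definition tilt (sigma s y : R) : R :=
  expR (s * y / sigma ^+ 2 - s ^+ 2 / (2 * sigma ^+ 2)).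

Lemma tilt_gt0 sigma s y : (0 < tilt sigma s y)%R.
Proof. exact: expR_gt0. Qed.

Lemma measurable_tilt sigma s : measurable_fun setT (tilt sigma s).
Proof.
apply: measurableT_comp => //; apply: measurable_funB => //.
by apply: measurable_funM => //; exact: measurable_funM.
Qed.

(** Changing the sign of [s] flips the linear part of the exponent and keeps the quadratic one, so
    an inverse density is again a density up to a constant. This makes the mean of the inverse
    likelihood ratio computable. *)
Lemma tiltN sigma s y : (sigma != 0)%R ->
  (expR (s ^+ 2 / sigma ^+ 2) * tilt sigma (- s) y = (tilt sigma s y)^-1)%R.
Proof. by move=> s0; rewrite /tilt -expRD -expRN; congr expR; field. Qed.

(** Cameron-Martin in dimension one: after a translation of the Lebesgue integral by [s], it remains
    to see that [tilt sigma s (x + s)] times the density at [x + s] is the density at [x], by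
    completing the square. *)
Lemma ge0_integral_normal_shift (sigma s : R) (f : R -> \bar R) :
  (sigma != 0)%R -> measurable_fun setT f -> (forall x, 0 <= f x) ->
  \int[normal_prob 0 sigma]_y f (y + s)%R =
  \int[normal_prob 0 sigma]_y (f y * (tilt sigma s y)%:E).
Proof.
move=> s0 mf f0.
have mfs : measurable_fun setT (fun y : R => f (y + s)%R).
  by apply: (measurableT_comp mf); exact: measurable_funD.
rewrite ge0_integral_normal_prob// ge0_integral_normal_prob//; last 2 first.
- by apply: emeasurable_funM => //; apply/measurable_EFinP; exact: measurable_tilt.
- by move=> x; rewrite mule_ge0// lee_fin ltW// tilt_gt0.
rewrite -[RHS](ge0_integral_addr s); last 2 first.
- apply: emeasurable_funM; last by apply/measurable_EFinP; exact: measurable_normal_pdf.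
  by apply: emeasurable_funM => //; apply/measurable_EFinP; exact: measurable_tilt.
- by move=> x; rewrite !mule_ge0// lee_fin ?normal_pdf_ge0// ltW// tilt_gt0.
apply: eq_integral => x _; rewrite -muleA -EFinM; congr (_ * _%:E).
rewrite !normal_pdfE// mulrCA; congr (_ * _)%R.
by rewrite /tilt /normal_fun -expRD; congr expR; field.
Qed.

Lemma integral_normal_cst (m s c : R) :
  \int[normal_prob m s]_y (cst c%:E y) = c%:E.
Proof.
by rewrite -[RHS]mule1 -(@probability_setT _ _ _ (normal_prob m s)); exact: integral_cst.
Qed.

(** For the constant 1 the shift formula says that [tilt] has mean 1; for the shift
    [s * sigma ^+ 2], [tilt] is [expR (s * y)] divided by the claimed value. *)
Lemma integral_normal_expR (sigma s : R) : (sigma != 0)%R ->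
  \int[normal_prob 0 sigma]_y (expR (s * y))%:E = (expR (s ^+ 2 * sigma ^+ 2 / 2))%:E.
Proof.
move=> s0.
have /esym := @ge0_integral_normal_shift sigma (s * sigma ^+ 2) (cst 1%E) s0
  (measurable_cst _) (fun=> lee01).
rewrite integral_normal_cst => /(congr1 (fun e => e * (expR (s ^+ 2 * sigma ^+ 2 / 2))%:E)).
rewrite mul1e -ge0_integralZr// ?lee_fin ?expR_ge0//; last 2 first.
- by apply: emeasurable_funM => //; apply/measurable_EFinP; exact: measurable_tilt.
- by move=> x _; rewrite /cst mul1e lee_fin ltW// tilt_gt0.
move=> <-; apply: eq_integral => x _; rewrite /cst mul1e -EFinM; congr (_%:E).
by rewrite /tilt -expRD; congr expR; field.
Qed.

(** With [x = 2 * y] and [e = expR y], the right-hand side minus 2 is the square of [e - e^-1], so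
    [2 * y <= e - e^-1] suffices for [y >= 0]. *)
Lemma expR_two_sided_ge (x : R) : (2 + x ^+ 2 <= expR x + expR (- x))%R.
Proof.
wlog x0 : x / (0 <= x)%R.
  move=> H; have [x0|x0] := lerP 0%R x; first exact: H.
  have := H (- x)%R; rewrite opprK sqrrN (addrC (expR (- x))); apply; lra.
have h2 (y : R) : (0 <= y -> 1 + y + y ^+ 2 / 2 <= expR y)%R.
  move=> y0; rewrite /expR.
  apply: le_trans (@nondecreasing_cvgn_le _ (series (exp_coeff y)) _ _ 3%N).
  - rewrite /series /= !big_nat_recr//= big_nil /exp_coeff /=.
    by rewrite expr0 expr1 !factS fact0 /= !muln1 divr1 add0r divr1.
  - apply: nondecreasing_series => i _ _.
    by rewrite /exp_coeff /= divr_ge0// exprn_ge0.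
  - exact: is_cvg_series_exp_coeff.
pose y := (x / 2)%R; have y0 : (0 <= y)%R by rewrite /y; lra.
have -> : x = (y + y)%R by rewrite /y; lra.
rewrite opprD !expRD expRN; have := h2 _ y0; set e := expR y => he.
have e0 : (0 < e)%R by exact: expR_gt0.
(* The two quadratic truncations multiply to [1 + y ^+ 4 / 4], which is at least 1, and they differ
   by [2 * y]. *)
have : (e^-1 <= 1 - y + y ^+ 2 / 2)%R.
  rewrite -[leLHS]mul1r ler_pdivrMr//.
  apply: (@le_trans _ _ ((1 - y + y ^+ 2 / 2) * (1 + y + y ^+ 2 / 2)))%R.
    nra.
  by apply: ler_wpM2l => //; nra.
move=> ie; have ei : (e * e^-1 = 1)%R by rewrite divff// gt_eqF.
have : (2 * y <= e - e^-1)%R by lra.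
nra.
Qed.

(* The first two moments of the centered normal law are read off its moment
   generating function: integrate 2 + (s y)^2 <= exp (s y) + exp (- s y) and
   1 + s y <= exp (s y), and let s tend to 0. *)
Lemma expR_sub1_mul_le (u : R) : (0 <= u < 1 -> (expR u - 1) * (1 - u) <= u)%R.
Proof.
move=> /andP[u0 u1]; have := expR_ge1Dx (- u); rewrite expRN.
set e := expR u => h; have e0 : (0 < e)%R by exact: expR_gt0.
have : ((1 - u) * e <= 1)%R by rewrite -ler_pdivlMr// div1r.
nra.
Qed.

Lemma le_of_expR_bound (v a : R) : (0 < a -> 0 <= v ->
  (forall u, 0 < u -> 2 + 2 * u / a * v <= 2 * expR u) -> v <= a)%R.
Proof.
move=> a0 v0 mgf; rewrite leNgt; apply/negP => av.
have vp : (0 < v)%R by exact: lt_trans av.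
(* Together with [expR_sub1_mul_le] the bound forces [v * (1 - u) <= a], that is [u >= 1 - a / v].
   Half of this threshold is a contradiction, without passing to a limit. *)
pose u := ((v - a) / (2 * v))%R.
have uE : (u * v = (v - a) / 2)%R by rewrite /u; field; rewrite gt_eqF.
have u0 : (0 < u)%R by rewrite divr_gt0//; lra.
have u1 : (u < 1)%R by rewrite ltr_pdivrMr; lra.
have := mgf u u0; have := @expR_sub1_mul_le u; rewrite u1 ltW// => /(_ isT).
set e := expR u => h1 h2.
have : (u * v / a <= e - 1)%R by lra.
rewrite ler_pdivrMr// => h3.
have : (u * v * (1 - u) <= u * a)%R.
  by apply: le_trans (_ : (e - 1) * a * (1 - u) <= _)%R; nra.
rewrite -mulrA ler_pM2l// => h4; nra.
Qed.

Lemma eq0_of_expR_bound (r a : R) : (0 < a ->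
  (forall s, 1 + s * r <= expR (s ^+ 2 * a / 2)) -> r = 0)%R.
Proof.
move=> s2 mgf; apply/eqP; apply: contraT => r0.
have r2 : (0 < r ^+ 2)%R by rewrite exprn_even_gt0.
(* For the test value [s = k * r], the numbers [k], [c = k * a] and [d = k * r ^+ 2] are positive
   with sum 1, and [u = d * c / 2]. The bound gives [1 - u <= c / 2], impossible when [c] and [d]
   are below 1. *)
pose k := ((1 + a + r ^+ 2)^-1)%R.
have k0 : (0 < k)%R by rewrite invr_gt0; lra.
have kE : (k * (1 + a + r ^+ 2) = 1)%R.
  by rewrite mulVf// gt_eqF// addr_gt0// addr_gt0.
have := mgf (k * r)%R.
set u := (_ / 2)%R => b.
have uE : (u = (k * r ^+ 2) * (k * a) / 2)%R by rewrite /u; ring.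
set d := (k * r ^+ 2)%R in uE; set c := (k * a)%R in uE.
have d0 : (0 < d)%R by exact: mulr_gt0.
have c0 : (0 < c)%R by exact: mulr_gt0.
have dc : (k + c + d = 1)%R by rewrite /d /c -kE; ring.
have u1 : (0 <= u < 1)%R by rewrite uE; apply/andP; split; nra.
have := expR_sub1_mul_le u1.
have : (d <= expR u - 1)%R by rewrite /d; move: b; rewrite -mulrA -expr2; lra.
set e := expR u => h1 h2.
have h3 : (d * (1 - u) <= d * c / 2)%R.
  rewrite -uE; apply: le_trans h2; apply: ler_wpM2r => //; lra.
have h4 : (1 - u <= c / 2)%R by move: h3; rewrite -mulrA ler_pM2l.
exfalso; nra.
Qed.

Lemma normal_second_moment_le (sigma : R) : (sigma != 0)%R ->
  \int[normal_prob 0 sigma]_y (y ^+ 2)%:E <= (sigma ^+ 2)%:E.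
Proof.
move=> s0; set V := integral _ _ _.
have V0 : 0 <= V by apply: integral_ge0 => x _; rewrite lee_fin sqr_ge0.
have mgf_bnd (s : R) :
    2%:E + (s ^+ 2)%:E * V <= (2 * expR (s ^+ 2 * sigma ^+ 2 / 2))%:E.
  have -> : (2 * expR (s ^+ 2 * sigma ^+ 2 / 2))%:E =
      \int[normal_prob 0 sigma]_y (expR (s * y))%:E +
      \int[normal_prob 0 sigma]_y (expR (- s * y))%:E.
    by rewrite !integral_normal_expR// sqrrN -EFinD mulr_natl mulr2n.
  rewrite -ge0_integralD//; last 2 first.
  - by apply/measurable_EFinP; apply: measurableT_comp => //; exact: measurable_funM.
  - by apply/measurable_EFinP; apply: measurableT_comp => //; exact: measurable_funM.
  rewrite /V -ge0_integralZl ?lee_fin ?sqr_ge0//; last 2 first.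
  - by apply/measurable_EFinP; exact: measurable_funX.
  - by move=> x _; rewrite lee_fin sqr_ge0.
  have -> : 2%:E = \int[normal_prob 0 sigma]_y (cst 2%:E y).
    by rewrite integral_normal_cst.
  rewrite -ge0_integralD//; last 3 first.
  - by move=> x _; rewrite lee_fin.
  - by move=> x _; rewrite -EFinM lee_fin mulr_ge0 ?sqr_ge0.
  - apply/measurable_EFinP; apply: measurable_funM => //; exact: measurable_funX.
  apply: ge0_le_integral => //.
  - by move=> x _; rewrite -EFinM -EFinD lee_fin addr_ge0// mulr_ge0// sqr_ge0.
  - apply/measurable_EFinP; apply: measurable_funD => //.
    apply: measurable_funM => //; exact: measurable_funX.
  - apply/measurable_EFinP; apply: measurable_funD => //.
    + by apply: measurableT_comp => //; exact: measurable_funM.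
    + by apply: measurableT_comp => //; exact: measurable_funM.
  - move=> x _; rewrite -EFinM -!EFinD lee_fin.
    by have := expR_two_sided_ge (s * x); rewrite mulNr exprMn.
(* [V] lives in the extended reals; the bound at [s = 1] excludes [+oo]. *)
have Vfin : V \is a fin_num.
  have := mgf_bnd 1%R; rewrite expr1n mul1e ge0_fin_numE// => h.
  rewrite ltey; apply/eqP => Vy; move: h; rewrite Vy addey//.
have [v0 vE] : (0 <= fine V)%R /\ V = (fine V)%:E.
  by split; [exact: fine_ge0|rewrite fineK].
have s2 : (0 < sigma ^+ 2)%R by rewrite exprn_even_gt0.
rewrite vE lee_fin; apply: le_of_expR_bound => // u u0.
have := mgf_bnd (Num.sqrt (2 * u / sigma ^+ 2)).
rewrite sqr_sqrtr; last by rewrite divr_ge0 ?(ltW s2)// mulr_ge0// ltW.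
rewrite vE -EFinM -EFinD lee_fin.
by rewrite (_ : 2 * u / sigma ^+ 2 * sigma ^+ 2 / 2 = u)%R; last by field.
Qed.

Lemma normr_le_1_sqr (x : R) : (`|x| <= 1 + x ^+ 2)%R.
Proof.
have := sqr_ge0 (`|x| - 1)%R; rewrite sqrrB1 real_normK ?num_real//.
by have := normr_ge0 x; lra.
Qed.

Lemma integrable_normal_id (sigma : R) : (sigma != 0)%R ->
  (normal_prob 0 sigma).-integrable setT (EFin : R -> \bar R).
Proof.
move=> s0; apply/integrableP; split; first exact/measurable_EFinP.
apply: (@le_lt_trans _ _ (\int[normal_prob 0 sigma]_y (cst 1 y + (y ^+ 2)%:E))).
  apply: ge0_le_integral => //.
  - by apply: measurableT_comp => //; exact/measurable_EFinP.
  - apply: emeasurable_funD => //; apply/measurable_EFinP; exact: measurable_funX.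
  - move=> x _ /=; rewrite lee_fin.
    exact: normr_le_1_sqr.
rewrite ge0_integralD//; last 2 first.
- by move=> x _; rewrite lee_fin sqr_ge0.
- apply/measurable_EFinP; exact: measurable_funX.
rewrite lte_add_pinfty//; last exact: le_lt_trans (normal_second_moment_le s0) (ltry _).
by rewrite integral_normal_cst ltry.
Qed.

Lemma normal_mean (sigma : R) : (sigma != 0)%R ->
  \int[normal_prob 0 sigma]_y y%:E = 0.
Proof.
move=> s0; have id1 := integrable_normal_id s0.
set m := integral _ _ _.
have mfin : m \is a fin_num by exact: integrable_fin_num.
have mE : m = (fine m)%:E by rewrite fineK.
have mgf_bnd (s : R) : (1 + s * fine m <= expR (s ^+ 2 * sigma ^+ 2 / 2))%R.
  rewrite -lee_fin EFinD EFinM -mE -integral_normal_expR// /m -integralZl//.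
  have -> : 1%:E = \int[normal_prob 0 sigma]_y (cst 1%:E y).
    by rewrite integral_normal_cst.
  rewrite -integralD//; last 2 first.
  - exact: finite_measure_integrable_cst.
  - exact: integrableZl.
  apply: le_integral => //.
  - apply: integrableD => //; first exact: finite_measure_integrable_cst.
    exact: integrableZl.
  - apply/integrableP; split.
      by apply/measurable_EFinP; apply: measurableT_comp => //; exact: measurable_funM.
    under eq_integral do rewrite gee0_abs ?lee_fin ?expR_ge0//.
    by rewrite integral_normal_expR// ltry.
  - by move=> x _; rewrite -EFinM -EFinD lee_fin; exact: expR_ge1Dx.
rewrite mE; congr (_%:E); apply: (@eq0_of_expR_bound _ (sigma ^+ 2)) => //.
by rewrite exprn_even_gt0.
Qed.

End Gaussian.

(** * Shifting finitely many noise samples *)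

Section Paths.
Context {R : realType} {n : nat} {dU : measure_display} {U : measurableType dU}.

Definition box (A : set U) (K : nat) (B : 'I_n -> nat -> set R) :
    set (U * ('I_n -> nat -> R)) :=
  [set p | A p.1 /\ forall i k, (k < K)%N -> B i k (p.2 i k)].

Definition boxes : set (set (U * ('I_n -> nat -> R))) :=
  [set X | exists A K B, [/\ measurable A, forall i k, measurable (B i k) & X = box A K B]].

(* The information available to a method: the seed and all the noise samples.
   Boxes with finitely many constraints form a pi-system on which
   [independent_samples] prescribes the law. *)
Definition paths := g_sigma_algebraType boxes.

Lemma box_widen A K K' B : (K <= K')%N ->
  box A K B = box A K' (fun i k => if (k < K)%N then B i k else setT).
Proof.
move=> KK; apply/seteqP; split=> -[u z] /= [Au zB]; split=> // i k kK.
- by case: ifP => // kK'; exact: zB.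
- by have := zB i k (leq_trans kK KK); rewrite kK.
Qed.

Lemma boxesI : setI_closed boxes.
Proof.
move=> _ _ [A [K [B [mA mB ->]]]] [A' [K' [B' [mA' mB' ->]]]].
exists (A `&` A'), (maxn K K'),
  (fun i k => (if (k < K)%N then B i k else setT) `&` (if (k < K')%N then B' i k else setT)).
split; first exact: measurableI.
  by move=> i k; apply: measurableI; case: ifP.
rewrite (@box_widen A _ _ B (leq_maxl K K')) (@box_widen A' _ _ B' (leq_maxr K K')).
apply/seteqP; split=> -[u z] /=.
  by move=> [[Au zB] [A'u zB']]; split=> // i k kK; split; [exact: zB|exact: zB'].
by move=> [[Au A'u] zB]; split; split=> // i k kK; have [] := zB i k kK.
Qed.

Lemma measurable_box A K B : measurable A -> (forall i k, measurable (B i k)) ->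
  measurable (box A K B : set paths).
Proof. by move=> mA mB; apply: sub_sigma_algebra; exists A, K, B. Qed.

Lemma measurable_path_seed : measurable_fun setT (fst : paths -> U).
Proof.
move=> _ A mA; rewrite setTI.
rewrite (_ : _ @^-1` _ = box A 0 (fun _ _ => setT)); first exact: measurable_box.
by apply/seteqP; split=> -[u z] /=; [|case].
Qed.

Lemma measurable_path_noise i k : measurable_fun setT (fun p : paths => p.2 i k).
Proof.
move=> _ B mB; rewrite setTI.
rewrite (_ : _ @^-1` _ =
  box setT k.+1 (fun i' k' => if (i' == i) && (k' == k) then B else setT)).
  by apply: measurable_box => // i' k'; case: ifP.
apply/seteqP; split=> -[u z] /=.
  by move=> Bz; split=> // i' k' _; case: ifP => // /andP[/eqP -> /eqP ->].
by move=> [_ /(_ i k (ltnSn k))]; rewrite !eqxx.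
Qed.

Lemma measurable_fun_path d (X : measurableType d) (f : X -> paths) :
  measurable_fun setT (fun x => (f x).1) ->
  (forall i k, measurable_fun setT (fun x => (f x).2 i k)) ->
  measurable_fun setT f.
Proof.
move=> m1 m2; apply: (@measurability _ _ _ _ setT f boxes) => //.
move=> _ [_ [A [K [B [mA mB ->]]]] <-].
(* The worker index runs over all naturals so that countable intersections apply; for [i >= n] the
   condition on [ii] is void. *)
rewrite (_ : _ `&` _ = ((fun x => (f x).1) @^-1` A) `&`
  \bigcap_i \bigcap_(k in [set k | (k < K)%N])
     (fun x => forall ii : 'I_n, val ii = i -> B ii k ((f x).2 ii k))).
  apply: measurableI; first by rewrite -[X in measurable X]setTI; exact: m1.
  apply: bigcap_measurableType => i _; apply: bigcap_measurableType => k _.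
  have [ilt|ilt] := ltnP i n; last first.
    rewrite (_ : (fun x => _) = setT)//; apply/seteqP; split=> // x _ ii iiE.
    by move: (ltn_ord ii); rewrite iiE ltnNge ilt.
  rewrite (_ : (fun x => _) = (fun x => (f x).2 (Ordinal ilt) k) @^-1` B (Ordinal ilt) k).
    by rewrite -[X in measurable X]setTI; exact: m2.
  apply/seteqP; split=> x /=; first exact.
  by move=> h ii iiE; rewrite (_ : ii = Ordinal ilt)//; exact: val_inj.
apply/seteqP; split=> x /=.
  by move=> [_ [Ax Bx]]; split=> // i _ k kK ii _; exact: Bx.
by move=> [Ax Bx]; split=> //; split=> // i k kK; exact: (Bx i I k kK i).
Qed.

Lemma paths_measure_unique (m1 m2 : {measure set paths -> \bar R}) :
  (m1 setT < +oo)%E ->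
  (forall A K B, measurable A -> (forall i k, measurable (B i k)) ->
    m1 (box A K B) = m2 (box A K B)) ->
  forall X, measurable X -> m1 X = m2 X.
Proof.
move=> m1oo m12; have boxT : setT = box setT 0 (fun _ _ => setT).
  by apply/seteqP; split=> x.
apply: (@measure_unique _ _ paths boxes (fun=> setT)) => //.
- exact: boxesI.
- by move=> _; exists setT, 0%N, (fun _ _ => setT).
- by apply/seteqP; split=> // x _; exists 0%N.
- by move=> _ [A [K [B [mA mB ->]]]]; exact: m12.
Qed.

Definition update (z : 'I_n -> nat -> R) i k y : 'I_n -> nat -> R :=
  fun j l => if (j == i) && (l == k) then y else z j l.

Context {d : measure_display} {Omega : measurableType d} (P : probability Omega R)
  (seed : {RV P >-> U}) (noise : 'I_n -> nat -> {RV P >-> R}).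
Context (sigma : R) (normal : normal_noise sigma noise)
  (indep : independent_samples seed noise).

Definition path_of (w : Omega) : paths := (seed w, fun i k => noise i k w).

Lemma measurable_path_of : measurable_fun setT path_of.
Proof. by apply: measurable_fun_path => [|i k]; exact: measurable_funPT. Qed.

Lemma measurable_update i k :
  measurable_fun setT (fun p : paths * R => (p.1.1, update p.1.2 i k p.2) : paths).
Proof.
apply: measurable_fun_path => [|j l] /=.
  exact: (measurableT_comp measurable_path_seed measurable_fst).
rewrite /update; case: (_ && _); first exact: measurable_snd.
exact: (measurableT_comp (f := fun p : paths => p.2 j l)
  (measurable_path_noise j l) measurable_fst).
Qed.

Lemma prob_box A K B : measurable A -> (forall i k, measurable (B i k)) ->
  P (path_of @^-1` box A K B) =
  (P (seed @^-1` A) * \prod_(q : 'I_n * 'I_K) normal_prob 0 sigma (B q.1 q.2))%E.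
Proof.
move=> mA mB; rewrite (_ : path_of @^-1` _ = seed @^-1` A `&`
       [set w | forall i k, (k < K)%N -> B i k (noise i k w)]); last first.
  by apply/seteqP; split=> w; exact.
rewrite indep// pair_bigA/=; congr (_ * _)%E; apply: eq_bigr => q _.
exact: normal.
Qed.

(* By independence the sample [noise i k] may be replaced by a fresh normal
   variable, which reduces a shift of it to a one-dimensional statement. *)
Lemma integral_resample (g : paths -> \bar R) i k :
  measurable_fun setT g -> (forall p, 0 <= g p)%E ->
  (\int[P]_w g (path_of w) =
   \int[P]_w \int[normal_prob 0 sigma]_y g ((path_of w).1, update (path_of w).2 i k y))%E.
Proof.
move=> mg g0.
pose N : probability (measurableTypeR R) R := normal_prob 0 sigma.
pose h (p : Omega * measurableTypeR R) : paths := ((path_of p.1).1, update (path_of p.1).2 i k p.2).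
have mq : measurable_fun setT (fun p : Omega * measurableTypeR R => (path_of p.1, p.2 : R)).
  apply: measurable_fun_pair => //.
  exact: (measurableT_comp measurable_path_of measurable_fst).
have mh : measurable_fun setT h by exact: (measurableT_comp (measurable_update i k) mq).
transitivity (\int[P \x N]_p (g \o h) p)%E; last first.
  apply: (fubini_tonelli1 (m1 := P) (m2 := N) (g \o h)).
    exact: measurableT_comp.
  by move=> x; exact: g0.
rewrite -(@ge0_integral_pushforward _ _ _ _ _ _ measurable_path_of P setT g)//.
rewrite -(@ge0_integral_pushforward _ _ _ _ _ _ mh (P \x N)%E setT g)//.
apply: eq_measure_integral => [|mp X mX _]; first exact: measurable_path_of.
apply: paths_measure_unique => //.
  by apply: (@le_lt_trans _ _ (P setT)); [exact: lexx|rewrite probability_setT ltry].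
move=> A K B mA mB.
(* The bound [K'] exceeds [k], so the product of probabilities has a factor [q0] for the resampled
   coordinate. [C] frees that coordinate, whose constraint moves to the fresh variable. *)
pose K' := maxn K k.+1.
pose B' (j : 'I_n) l := if (l < K)%N then B j l else setT.
have -> : box A K B = box A K' B' by apply: box_widen; exact: leq_maxl.
have mB' j l : measurable (B' j l) by rewrite /B'; case: ifP.
have kK : (k < K')%N by rewrite leq_maxr.
pose q0 : 'I_n * 'I_K' := (i, Ordinal kK).
pose C j l := if (j == i) && (l == k) then setT else B' j l.
have mC j l : measurable (C j l) by rewrite /C; case: ifP.
rewrite -[LHS]/(P (path_of @^-1` box A K' B')).
rewrite -[RHS]/((P \x N)%E (h @^-1` box A K' B')).
have -> : h @^-1` box A K' B' = (path_of @^-1` box A K' C) `*` (B' i k).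
  apply/seteqP; split=> -[w y] /=.
    move=> [Aw zB]; split.
      split=> // j l lK; rewrite /C; case: ifP => // jl.
      by have := zB j l lK; rewrite /= /update jl.
    by have := zB i k kK; rewrite /= /update !eqxx.
  move=> [[Aw zC] By]; split=> // j l lK; rewrite /= /update.
  case: ifP => [/andP[/eqP -> /eqP ->]//|jl].
  by have := zC j l lK; rewrite /C jl.
have mbox : measurable (path_of @^-1` box A K' C).
  rewrite -[X in measurable X]setTI; apply: (measurable_path_of measurableT).
  exact: measurable_box.
rewrite product_measure1E//; last exact: mB'.
rewrite -[X in _ = (X * _)%E]/(P (path_of @^-1` box A K' C)).
rewrite (prob_box K' mA mB') (prob_box K' mA mC) -muleA; congr (_ * _)%E.
rewrite (bigD1 q0)//= [in RHS](bigD1 q0)//= /C !eqxx /=.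
rewrite (_ : normal_prob 0 sigma setT = 1%E) ?mul1e; last exact: (probability_setT N).
rewrite muleC; congr (_ * _)%E; apply: eq_bigr => -[j l] /= jl.
case: ifP => // /andP[/eqP ji /eqP lk]; case/negP: jl.
by apply/eqP; congr (_, _) => //; exact: val_inj.
Qed.

(** Only finitely many samples are shifted: shifting all samples of one worker by a nonzero amount
    would give a law singular to the original one, with no likelihood ratio. *)
Definition shift_first (i : 'I_n) (N : nat) (s : R) (p : paths) : paths :=
  (p.1, fun j l => p.2 j l + (if (j == i) && (l < N)%N then s else 0)).

Lemma measurable_shift_first i N s : measurable_fun setT (shift_first i N s).
Proof.
apply: measurable_fun_path => [|j l]; first exact: measurable_path_seed.
apply: measurable_funD => //; exact: measurable_path_noise.
Qed.

Definition path_tilt (i : 'I_n) (N : nat) (s : R) (p : paths) : R :=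
  \prod_(l < N) tilt sigma s (p.2 i l).

Lemma path_tilt_gt0 i N s p : 0 < path_tilt i N s p.
Proof. by apply: prodr_gt0 => l _; exact: tilt_gt0. Qed.

Lemma measurable_path_tilt i N s : measurable_fun setT (path_tilt i N s).
Proof.
apply: measurable_prod => l _.
exact: (measurableT_comp (measurable_tilt sigma s) (measurable_path_noise i l)).
Qed.

Context (sigma0 : sigma != 0).

Lemma integral_shift_one (g : paths -> \bar R) i k s :
  measurable_fun setT g -> (forall p, 0 <= g p)%E ->
  (\int[P]_w g ((path_of w).1, update (path_of w).2 i k ((path_of w).2 i k + s)%R) =
   \int[P]_w (g (path_of w) * (tilt sigma s ((path_of w).2 i k))%:E))%E.
Proof.
move=> mg g0.
have mgu (p : paths) : measurable_fun setT (fun y : R => g (p.1, update p.2 i k y)).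
  apply: (measurableT_comp mg).
  exact: (measurableT_comp (measurable_update i k) (pair1_measurable p)).
pose g1 (p : paths) := g (p.1, update p.2 i k (p.2 i k + s)).
have mg1 : measurable_fun setT g1.
  apply: (measurableT_comp mg).
  have mq : measurable_fun setT (fun p : paths => (p, p.2 i k + s)).
    apply: measurable_fun_pair => //.
    by apply: measurable_funD => //; exact: measurable_path_noise.
  exact: (measurableT_comp (measurable_update i k) mq).
pose g2 (p : paths) := (g p * (tilt sigma s (p.2 i k))%:E)%E.
have mg2 : measurable_fun setT g2.
  apply: emeasurable_funM => //; apply/measurable_EFinP.
  exact: (measurableT_comp (measurable_tilt sigma s) (measurable_path_noise i k)).
have g20 p : (0 <= g2 p)%E by rewrite mule_ge0// lee_fin ltW// tilt_gt0.
transitivity (\int[P]_w g1 (path_of w))%E; first by [].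
transitivity (\int[P]_w g2 (path_of w))%E; last by [].
rewrite (integral_resample i k mg1 (fun=> g0 _)).
transitivity (\int[P]_w \int[normal_prob 0 sigma]_y
    g2 ((path_of w).1, update (path_of w).2 i k y))%E; last first.
  exact/esym/(integral_resample i k mg2 g20).
have updK z y y' : update (update z i k y) i k y' = update z i k y'.
  by apply/funext => j; apply/funext => l; rewrite /update; case: (_ && _).
have updE z y : update z i k y i k = y by rewrite /update !eqxx.
apply: eq_integral => w _; rewrite /g1 /g2 /=.
under eq_integral do rewrite updK updE.
under [RHS]eq_integral do rewrite updE.
exact: (ge0_integral_normal_shift
  (f := fun y => g (seed w, update (fun j l => noise j l w) i k y)) s sigma0 (mgu (path_of w))).
Qed.

(** Sample [N] is handled by the one-sample formula, and its factor [tilt] is absorbed into the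
    integrand, to which the induction hypothesis applies; hence [g] is general in the induction. *)
Lemma integral_shift_first (g : paths -> \bar R) i N s :
  measurable_fun setT g -> (forall p, 0 <= g p)%E ->
  (\int[P]_w g (shift_first i N s (path_of w)) =
   \int[P]_w (g (path_of w) * (path_tilt i N s (path_of w))%:E))%E.
Proof.
elim: N g => [|N IH] g mg g0.
  apply: eq_integral => w _; rewrite /path_tilt big_ord0 mule1; congr g.
  rewrite /shift_first; case: (path_of w) => u z /=; congr pair.
  by apply/funext => j; apply/funext => l; rewrite andbF addr0.
pose g1 p := g (shift_first i N s p).
have mg1 : measurable_fun setT g1.
  exact: (measurableT_comp mg (measurable_shift_first i N s)).
pose g2 (p : paths) := (g p * (tilt sigma s (p.2 i N))%:E)%E.
have mg2 : measurable_fun setT g2.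
  apply: emeasurable_funM => //; apply/measurable_EFinP.
  exact: (measurableT_comp (measurable_tilt sigma s) (measurable_path_noise i N)).
have g20 p : (0 <= g2 p)%E by rewrite mule_ge0// lee_fin ltW// tilt_gt0.
transitivity (\int[P]_w g1 ((path_of w).1, update (path_of w).2 i N ((path_of w).2 i N + s)%R))%E.
  apply: eq_integral => w _; rewrite /g1 /shift_first /=; congr (g (_, _)).
  apply/funext => j; apply/funext => l; rewrite /update ltnS leq_eqVlt.
  have [->|ji] /= := eqVneq j i; last by [].
  by have [->|lN] /= := eqVneq l N; rewrite ?ltnn ?addr0.
rewrite (integral_shift_one i N s mg1 (fun=> g0 _)).
transitivity (\int[P]_w g2 (shift_first i N s (path_of w)))%E.
  by apply: eq_integral => w _; rewrite /g2 /g1 /= ltnn andbF addr0.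
rewrite IH//; apply: eq_integral => w _.
by rewrite /g2 /path_tilt big_ord_recr/= -muleA -EFinM; congr (_ * _%:E)%E; rewrite mulrC.
Qed.

Lemma path_tiltV i N s p : (path_tilt i N s p)^-1 =
  expR (N%:R * (s ^+ 2 / sigma ^+ 2)) * path_tilt i N (- s) p.
Proof.
rewrite /path_tilt -prodfV expRM_natl -[in X in _ ^+ X](card_ord N) -prodr_const.
by rewrite -big_split/=; apply: eq_bigr => l _; rewrite tiltN.
Qed.

(** This mean is one plus the chi-square divergence of the unshifted law from the shifted one. By
    [path_tiltV] it is a constant times the total mass of the law shifted by [- s]. *)
Lemma integral_path_tiltV i N s :
  (\int[P]_w ((path_tilt i N s (path_of w))^-1)%:E =
   (expR (N%:R * (s ^+ 2 / sigma ^+ 2)))%:E)%E.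
Proof.
have -> : (\int[P]_w ((path_tilt i N s (path_of w))^-1)%:E =
   \int[P]_w ((expR (N%:R * (s ^+ 2 / sigma ^+ 2)))%:E *
     (path_tilt i N (- s) (path_of w))%:E))%E.
  by apply: eq_integral => w _; rewrite -EFinM path_tiltV.
rewrite ge0_integralZl_EFin//; last 2 first.
- by move=> w _; rewrite lee_fin ltW// path_tilt_gt0.
- apply/measurable_EFinP.
  exact: (measurableT_comp (measurable_path_tilt i N (- s)) measurable_path_of).
have := @integral_shift_first (cst 1%E) i N (- s) (measurable_cst _) (fun=> lee01).
under [in RHS]eq_integral do rewrite /cst mul1e.
move=> <-; rewrite (_ : integral _ _ _ = 1)%E ?mule1//.
by rewrite -[RHS](@probability_setT _ _ _ P) -[RHS]mul1e; exact: integral_cst.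
Qed.

(** Both laws are weighted against the unshifted one. Adding [a ^+ 2] times the mean of each inverse
    ratio brings the total to at least [4 * a ^+ 2], and the hypothesis caps what was added at
    [3 * a ^+ 2]. *)
Lemma two_point_lower_bound (h : paths -> R) i N s a :
  measurable_fun setT h -> 0 <= a -> 2 * expR (N%:R * (s ^+ 2 / sigma ^+ 2)) <= 3 ->
  ((a ^+ 2)%:E <=
   \int[P]_w ((h (shift_first i N s (path_of w)) - a) ^+ 2)%:E +
   \int[P]_w ((h (shift_first i N (- s) (path_of w)) + a) ^+ 2)%:E)%E.
Proof.
move=> mh a0 hN.
rewrite (@integral_shift_first (fun p => ((h p - a) ^+ 2)%:E)); last 2 first.
- by apply/measurable_EFinP; apply: measurable_funX; exact: measurable_funB.
- by move=> p; rewrite lee_fin sqr_ge0.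
rewrite (@integral_shift_first (fun p => ((h p + a) ^+ 2)%:E)); last 2 first.
- by apply/measurable_EFinP; apply: measurable_funX; exact: measurable_funD.
- by move=> p; rewrite lee_fin sqr_ge0.
have mt r : measurable_fun setT (fun w => path_tilt i N r (path_of w)).
  exact: (measurableT_comp (measurable_path_tilt i N r) measurable_path_of).
have mhp : measurable_fun setT (fun w => h (path_of w)).
  exact: (measurableT_comp mh measurable_path_of).
have mtV r : measurable_fun setT (fun w => (path_tilt i N r (path_of w))^-1).
  under eq_fun do rewrite path_tiltV.
  exact: measurable_funM.
have V r : (\int[P]_w ((a ^+ 2)%:E * ((path_tilt i N r (path_of w))^-1)%:E) =
   (a ^+ 2 * expR (N%:R * (r ^+ 2 / sigma ^+ 2)))%:E)%E.
  rewrite ge0_integralZl_EFin ?sqr_ge0//; last 2 first.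
  - by move=> w _; rewrite lee_fin invr_ge0 ltW// path_tilt_gt0.
  - exact/measurable_EFinP.
  by rewrite integral_path_tiltV EFinM.
set A := (X in (_ <= X + _)%E); set B := (X in (_ <= _ + X)%E).
suff : ((4 * a ^+ 2)%:E <= (A + B) + (3 * a ^+ 2)%:E)%E.
  rewrite -leeBlDr// -EFinB (_ : 4 * a ^+ 2 - 3 * a ^+ 2 = a ^+ 2)//; ring.
apply: (@le_trans _ _ ((A + B) +
    ((a ^+ 2 * expR (N%:R * (s ^+ 2 / sigma ^+ 2)))%:E +
     (a ^+ 2 * expR (N%:R * ((- s) ^+ 2 / sigma ^+ 2)))%:E))%E); last first.
  rewrite leeD2l// -EFinD lee_fin sqrrN -mulrDr mulrC ler_wpM2r ?sqr_ge0//.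
  by move: hN; rewrite mulr_natl mulr2n.
rewrite -!V addeACA /A /B.
have mA (q : Omega -> R) r : measurable_fun setT q ->
    measurable_fun setT (fun w => (q w ^+ 2)%:E * (path_tilt i N r (path_of w))%:E)%E.
  by move=> mq; apply: emeasurable_funM; apply/measurable_EFinP => //; exact: measurable_funX.
have mV r : measurable_fun setT (fun w => (a ^+ 2)%:E * ((path_tilt i N r (path_of w))^-1)%:E)%E.
  by apply: emeasurable_funM; apply/measurable_EFinP.
have mB : measurable_fun setT (fun w => h (path_of w) - a) by exact: measurable_funB.
have mD : measurable_fun setT (fun w => h (path_of w) + a) by exact: measurable_funD.
have A0 (q : Omega -> R) r w : (0 <= (q w ^+ 2)%:E * (path_tilt i N r (path_of w))%:E)%E.
  by rewrite -EFinM lee_fin mulr_ge0 ?sqr_ge0// ltW// path_tilt_gt0.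
have V0 r w : (0 <= (a ^+ 2)%:E * ((path_tilt i N r (path_of w))^-1)%:E)%E.
  by rewrite -EFinM lee_fin mulr_ge0 ?sqr_ge0// invr_ge0 ltW// path_tilt_gt0.
have A0' r (q : Omega -> R) : forall w, [set: Omega] w ->
    (0 <= (q w ^+ 2)%:E * (path_tilt i N r (path_of w))%:E)%E by move=> w _; exact: A0.
have V0' r : forall w, [set: Omega] w ->
    (0 <= (a ^+ 2)%:E * ((path_tilt i N r (path_of w))^-1)%:E)%E by move=> w _; exact: V0.
rewrite -(ge0_integralD P measurableT (A0' s _) (mA _ s mB) (V0' s) (mV s)).
rewrite -(ge0_integralD P measurableT (A0' (- s) _) (mA _ (- s) mD) (V0' (- s)) (mV (- s))).
rewrite -(ge0_integralD P measurableT _ (emeasurable_funD (mA _ s mB) (mV s)) _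
  (emeasurable_funD (mA _ (- s) mD) (mV (- s)))); last 2 first.
- by move=> w _; apply: adde_ge0; [exact: (A0 (fun w => h (path_of w) - a))|exact: V0].
- by move=> w _; apply: adde_ge0; [exact: (A0 (fun w => h (path_of w) + a))|exact: V0].
rewrite -[leLHS]mule1 -(@probability_setT _ _ _ P) -integral_cst//.
apply: ge0_le_integral => //.
- by move=> w _; rewrite lee_fin mulr_ge0// sqr_ge0.
- by apply: emeasurable_funD; [exact: emeasurable_funD (mA _ s mB) (mV s)|
    exact: emeasurable_funD (mA _ (- s) mD) (mV (- s))].
move=> w _; rewrite -!EFinM -!EFinD lee_fin.
have := path_tilt_gt0 i N s (path_of w); have := path_tilt_gt0 i N (- s) (path_of w).
move: (path_tilt i N s _) (path_tilt i N (- s) _) (h (path_of w)) => p q x q0 p0.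
(* AM-GM turns |x - a| + |x + a| >= 2 a into the weighted bound; p and q are
   the likelihood ratios of the two shifted laws *)
have amgm (y r : R) : 0 < r -> 2 * a * `|y| <= y ^+ 2 * r + a ^+ 2 * r^-1.
  move=> r0; rewrite -subr_ge0 -(real_normK (num_real y)).
  rewrite (_ : _ - _ = (`|y| * r - a) ^+ 2 * r^-1).
    by rewrite mulr_ge0 ?sqr_ge0// invr_ge0 ltW.
  by field; rewrite gt_eqF.
apply: le_trans (lerD (amgm (x - a) p p0) (amgm (x + a) q q0)).
have : 2 * a <= `|x - a| + `|x + a|.
  have -> : 2 * a = `|(x + a) - (x - a)|.
    by rewrite (_ : x + a - (x - a) = 2 * a) ?ger0_norm//; [lra|ring].
  by rewrite (le_trans (ler_normB _ _))// addrC.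
by nra.
Qed.

End Paths.

(** * Measurability of the output of a method *)

Section Discrete.
Context {d : measure_display} {X : measurableType d}.

(* Measurability for the discrete sigma-algebra on a countable type; stated on
   fibers because types such as [seq 'I_n] carry no canonical one. *)
Definition discrete_measurable (T : Type) (g : X -> T) :=
  forall t, measurable [set x | g x = t].

(** The values of [g] cut the space into countably many measurable pieces, with a fixed [A t] on
    each. Later branches on the next worker or on the shape of a log go through this. *)
Lemma fiberwise_set (T : countType) (g : X -> T) (A : T -> set X) :
  discrete_measurable g -> (forall t, measurable (A t)) ->
  measurable [set x | A (g x) x].
Proof.
move=> mg mA.
rewrite (_ : [set x | _] = 
    \bigcup_k (if unpickle k is Some t then [set x | g x = t] `&` A t else set0)).
  by apply: bigcupT_measurable => k; case: unpickle => // t; apply: measurableI.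
apply/seteqP; split=> x /=.
  by move=> Ax; exists (pickle (g x)) => //; rewrite pickleK; split.
by move=> [k _]; case: unpickle => // t [/= ->].
Qed.

Lemma fiberwise_discrete (T : countType) (T' : Type) (g : X -> T) (F : T -> X -> T') :
  discrete_measurable g -> (forall t, discrete_measurable (F t)) ->
  discrete_measurable (fun x => F (g x) x).
Proof.
by move=> mg mF t'; apply: (fiberwise_set (A := fun t => [set x | F t x = t'])) => // t; exact: mF.
Qed.

Lemma fiberwise_fun (T : countType) d' (Y : measurableType d') (g : X -> T) (F : T -> X -> Y) :
  discrete_measurable g -> (forall t, measurable_fun setT (F t)) ->
  measurable_fun setT (fun x => F (g x) x).
Proof.
move=> mg mF _ B mB; rewrite setTI.
apply: (fiberwise_set (A := fun t => F t @^-1` B)) => // t.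
by rewrite -[X in measurable X]setTI; exact: mF.
Qed.

Lemma discrete_cst (T : Type) (t : T) : discrete_measurable (fun=> t).
Proof.
move=> t'; have [<-|tt'] := pselect (t = t').
  by rewrite (_ : [set x | _] = setT)//; apply/seteqP; split.
by rewrite (_ : [set x | _] = set0)//; apply/seteqP; split.
Qed.

Lemma discrete_comp (T : countType) (T' : Type) (g : X -> T) (phi : T -> T') :
  discrete_measurable g -> discrete_measurable (fun x => phi (g x)).
Proof.
move=> mg; apply: (fiberwise_discrete (F := fun t _ => phi t)) => // t.
exact: discrete_cst.
Qed.

Lemma discrete_pair (T T' : Type) (g : X -> T) (g' : X -> T') :
  discrete_measurable g -> discrete_measurable g' ->
  discrete_measurable (fun x => (g x, g' x)).
Proof.
move=> mg mg' [t t'].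
rewrite (_ : [set x | _] = [set x | g x = t] `&` [set x | g' x = t']).
  exact: measurableI.
by apply/seteqP; split=> x /= => [[-> ->]|[-> ->]].
Qed.

Lemma discrete_bool (b : X -> bool) : discrete_measurable b <-> measurable_fun setT b.
Proof.
split=> mb; first by apply: (measurable_fun_bool true); rewrite setTI; exact: mb.
by move=> t; rewrite -[X in measurable X]setTI; exact: (mb measurableT [set t]).
Qed.

Lemma discrete_ffun (I : finType) (b : I -> X -> bool) :
  (forall i, measurable_fun setT (b i)) -> discrete_measurable (fun x => [ffun i => b i x]).
Proof.
move=> mb t; rewrite (_ : [set x | _] = \bigcap_(i in [set: I]) [set x | b i x = t i]).
  apply: fin_bigcap_measurable => // i _.
  exact: (proj2 (discrete_bool _) (mb i)).
apply/seteqP; split=> x /=.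
  by move=> <- i _ /=; rewrite ffunE.
by move=> h; apply/ffunP => i; rewrite ffunE; exact: h.
Qed.

Lemma measurable_forall (I : finType) (b : I -> X -> bool) :
  (forall i, measurable_fun setT (b i)) ->
  measurable_fun setT (fun x => [forall i, b i x]).
Proof.
move=> mb; apply/discrete_bool.
rewrite (_ : (fun x => _) = fun x => [forall i, [ffun i => b i x] i]).
  exact: (discrete_comp (fun t : {ffun I -> bool} => [forall i, t i]) (discrete_ffun mb)).
by apply/funext => x; apply: eq_forallb => i; rewrite ffunE.
Qed.

End Discrete.

Section OutputMeasurable.
Context {R : realType} {n : nat} {dU : measure_display} {U : measurableType dU}.
Context (tau : 'I_n -> R) (M : method R n U).

(** The default 0 on an idle worker makes a job measurable by parts: a flag and real-valued
    components. *)
Definition job_start (o : option (R * 'rV[R]_n)) : R := if o is Some (s, _) then s else 0.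
Definition job_query (o : option (R * 'rV[R]_n)) : 'rV[R]_n := if o is Some (_, q) then q else 0.

Section OnSpace.
Context {d : measure_display} {X : measurableType d}.

(** A log of random length is described by its discrete sequence of workers and by the coordinates
    of its [k]-th gradient for every [k], read as 0 past the end. *)
Definition measurable_log (H : X -> log R n) :=
  discrete_measurable (fun x => unzip1 (H x)) /\
  forall k j, measurable_fun setT (fun x => nth 0 (unzip2 (H x)) k 0 j).

Definition measurable_jobs (p : X -> @jobs R n) := forall i,
  [/\ measurable_fun setT (fun x => isSome (p x i)),
      measurable_fun setT (fun x => job_start (p x i)) &
      forall j, measurable_fun setT (fun x => job_query (p x i) 0 j)].

Definition measurable_status (st : X -> @status R n) :=
  measurable_fun setT (fun x => clock (st x)) /\
  measurable_jobs (fun x => running (st x)).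

Lemma measurable_log_apply d' (T : measurableType d') (F : U -> log R n -> T)
    (u : X -> U) (H : X -> log R n) :
  log_measurable F -> measurable_fun setT u -> measurable_log H ->
  measurable_fun setT (fun x => F (u x) (H x)).
Proof.
move=> mF mu [mw mn].
(* Defined for every [w], also at points where the log has another shape; only its values on the
   fiber [unzip1 (H x) = w] matter. *)
pose y (w : seq 'I_n) (x : X) : (size w).-tuple (n.-tuple R) :=
  [tuple [tuple nth 0 (unzip2 (H x)) k 0 j | j < n] | k < size w].
have my w : measurable_fun setT (y w).
  apply/measurable_fun_tnthP => k; apply/measurable_fun_tnthP => j.
  rewrite (_ : _ \o _ = fun x => nth 0 (unzip2 (H x)) k 0 j)//.
  by apply/funext => x /=; rewrite !tnth_mktuple.
rewrite (_ : (fun x => _) = fun x => F (u x) (log_of (y (unzip1 (H x)) x))).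
  apply: (fiberwise_fun (F := fun w x => F (u x) (log_of (y w x)))) => // w.
  exact: (measurableT_comp (mF w) (measurable_fun_pair mu (my w))).
apply/funext => x; congr F; rewrite /log_of.
rewrite -[LHS]zip_unzip; congr zip.
apply: (@eq_from_nth _ 0) => [|k kH]; first by rewrite size_map [RHS]size_map size_tuple size_map.
have kw : (k < size (unzip1 (H x)))%N by rewrite size_map; rewrite size_map in kH.
rewrite (nth_map (tnth (y _ x) (Ordinal kw))); last by rewrite size_tuple.
rewrite -[k in RHS]/(nat_of_ord (Ordinal kw)) -tnth_nth.
by apply/rowP => j; rewrite !mxE !tnth_mktuple.
Qed.

Lemma measurable_finish p i : measurable_jobs p ->
  measurable_fun setT (fun x => finish tau (p x) i).
Proof.
move=> mp; have [m1 m2 _] := mp i.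
rewrite (_ : (fun x => _) = fun x =>
    if isSome (p x i) then (job_start (p x i) + tau i)%:E else +oo%E).
  apply: measurable_fun_ifT => //.
  by apply/measurable_EFinP; exact: measurable_funD.
by apply/funext => x; rewrite /finish /job_start; case: (p x i) => [[]|].
Qed.

Lemma discrete_next p : measurable_jobs p -> discrete_measurable (fun x => Defs.next tau (p x)).
Proof.
move=> mp.
pose b i x := (finish tau (p x) i < +oo)%E &&
  [forall j, (finish tau (p x) i <= finish tau (p x) j)%E].
have mb i : measurable_fun setT (b i).
  apply: measurable_and.
    by apply: measurable_fun_lte => //; exact: measurable_finish.
  by apply: measurable_forall => j; apply: measurable_fun_lee; exact: measurable_finish.
rewrite (_ : (fun x => _) = fun x => [pick i | [ffun i => b i x] i]).
  exact: (discrete_comp (fun t : {ffun 'I_n -> bool} => [pick i | t i]) (discrete_ffun mb)).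
by apply/funext => x; apply: eq_pick => i; rewrite ffunE.
Qed.

Lemma measurable_orders u H st : measurable_fun setT u -> measurable_log H ->
  measurable_status st ->
  measurable_jobs (fun x => orders M (u x) (H x) (st x)).
Proof.
move=> mu mH [mc mr] i; have [r1 r2 r3] := mr i.
have ml := measurable_log_apply (measurable_launch M i) mu mH.
have md := measurable_log_apply (measurable_delay M i) mu mH.
have mq j := measurable_log_apply (measurable_query M i j) mu mH.
split => [||j].
- rewrite (_ : (fun x => _) = fun x =>
    if launch M (u x) (H x) i then true else isSome (running (st x) i)).
    exact: measurable_fun_ifT.
  by apply/funext => x; rewrite /orders; case: ifP.
- rewrite (_ : (fun x => _) = fun x => if launch M (u x) (H x) i
    then clock (st x) + delay M (u x) (H x) i else job_start (running (st x) i)).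
    by apply: measurable_fun_ifT => //; exact: measurable_funD.
  by apply/funext => x; rewrite /orders; case: ifP.
- rewrite (_ : (fun x => _) = fun x => if launch M (u x) (H x) i
    then query M (u x) (H x) i 0 j else job_query (running (st x) i) 0 j).
    exact: measurable_fun_ifT.
  by apply/funext => x; rewrite /orders; case: ifP.
Qed.

Lemma measurable_advance p st : measurable_jobs p -> measurable_status st ->
  measurable_status (fun x => advance tau (p x) (st x)).
Proof.
move=> mp [mc mr]; have mN := discrete_next mp.
pose T i x := fine (finish tau (p x) i).
have mT i : measurable_fun setT (T i).
  by apply: (measurableT_comp _ (measurable_finish i mp)).
split; last move=> j.
  pose F := (fun o x => if o is Some i then T i x else clock (st x)).
  rewrite (_ : (fun x => _) = fun x => F (Defs.next tau (p x)) x).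
    by apply: (fiberwise_fun (F := F)) => // -[i|] //; exact: mT.
  by apply/funext => x; rewrite /advance; case: (Defs.next _ _).
have [p1 p2 p3] := mp j; have [r1 r2 r3] := mr j.
pose keep i x := [&& isSome (p x j), j != i & job_start (p x j) < T i x].
have mk i : measurable_fun setT (keep i).
  apply: measurable_and => //; apply: measurable_and => //.
  exact: measurable_fun_ltr.
have E x : running (advance tau (p x) (st x)) j =
    if Defs.next tau (p x) is Some i then (if keep i x then p x j else None) else running (st x) j.
  rewrite /advance; case: (Defs.next _ _) => [i|//] /=; rewrite /keep /T.
  by case: (p x j) => [[s q]|].
split => [||l].
- pose F := (fun o x => if o is Some i then keep i x else isSome (running (st x) j)).
  rewrite (_ : (fun x => _) = fun x => F (Defs.next tau (p x)) x).
    by apply: (fiberwise_fun (F := F)) => // -[i|]; [exact: mk|exact: r1].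
  apply/funext => x; rewrite E /F; case: (Defs.next _ _) => // i; rewrite /keep.
  by case: (p x j) => //= a; case: ifP.
- pose F := (fun o x => if o is Some i then (if keep i x then job_start (p x j) else 0)
    else job_start (running (st x) j)).
  rewrite (_ : (fun x => _) = fun x => F (Defs.next tau (p x)) x).
    by apply: (fiberwise_fun (F := F)) => // -[i|]; [exact: measurable_fun_ifT|exact: r2].
  by apply/funext => x; rewrite E /F; case: (Defs.next _ _) => // i; case: ifP.
- pose F := (fun o x => if o is Some i then (if keep i x then job_query (p x j) 0 l else 0)
    else job_query (running (st x) j) 0 l).
  rewrite (_ : (fun x => _) = fun x => F (Defs.next tau (p x)) x).
    by apply: (fiberwise_fun (F := F)) => // -[i|]; [exact: measurable_fun_ifT|exact: r3].
  by apply/funext => x; rewrite E /F; case: (Defs.next _ _) => // i; case: ifP => // _; rewrite mxE.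
Qed.

Lemma measurable_log_behead H : measurable_log H -> measurable_log (fun x => behead (H x)).
Proof.
move=> [m1 m2]; split=> [|k j].
  rewrite (_ : (fun x => _) = fun x => behead (unzip1 (H x))).
    exact: discrete_comp.
  by apply/funext => x; rewrite /unzip1 behead_map.
rewrite (_ : (fun x => _) = fun x => nth 0 (unzip2 (H x)) k.+1 0 j)//.
by apply/funext => x; case: (H x) => //= ; rewrite nth_nil.
Qed.

(** Fixing the sequence of workers turns the recursion of [status_of] over the log into an induction
    on [w]. *)
Lemma measurable_status_of_shape (w : seq 'I_n) u H :
  measurable_fun setT u -> measurable_log H -> (forall x, unzip1 (H x) = w) ->
  measurable_status (fun x => status_of tau M (u x) (H x)).
Proof.
elim: w H => [|i w IH] H mu mH Hw.
  rewrite (_ : (fun x => _) = fun x => Status 0 (fun=> None)).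
    by split=> //= i; split => //= j; rewrite /job_query.
  by apply/funext => x; have := Hw x; case: (H x).
have mH' := measurable_log_behead mH.
have mst : measurable_status (fun x => status_of tau M (u x) (behead (H x))).
  apply: IH => // x; have := Hw x; case: (H x) => //= a h [_].
  by [].
rewrite (_ : (fun x => _) = fun x =>
    advance tau (orders M (u x) (behead (H x)) (status_of tau M (u x) (behead (H x))))
      (status_of tau M (u x) (behead (H x)))).
  apply: measurable_advance => //; exact: measurable_orders.
by apply/funext => x; have := Hw x; case: (H x).
Qed.

End OnSpace.

Lemma measurable_log_of (w : seq 'I_n) :
  measurable_log (fun p : U * (size w).-tuple (n.-tuple R) => log_of p.2).
Proof.
split=> [|k j].
  rewrite (_ : (fun x => _) = fun=> w); first exact: discrete_cst.
  by apply/funext => -[u y]; rewrite unzip1_zip// size_map size_tuple.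
have [kw|wk] := ltnP k (size w); last first.
  rewrite (_ : (fun x => _) = cst 0)//; apply/funext => -[u y] /=.
  by rewrite nth_default ?mxE// unzip2_zip size_map size_tuple.
rewrite (_ : (fun x => _) = fun p => tnth (tnth p.2 (Ordinal kw)) j).
  apply: (measurableT_comp (measurable_tnth j)).
  exact: (measurableT_comp (measurable_tnth (Ordinal kw)) measurable_snd).
apply/funext => -[u y] /=.
rewrite unzip2_zip ?size_map ?size_tuple//.
rewrite (nth_map (tnth y (Ordinal kw))) ?size_tuple// mxE.
by rewrite -[k in nth _ _ k]/(nat_of_ord (Ordinal kw)) -tnth_nth.
Qed.

Lemma log_measurable_status :
  [/\ log_measurable (fun u h => clock (status_of tau M u h)),
   forall i, log_measurable (fun u h => isSome (running (status_of tau M u h) i)),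
   forall i, log_measurable (fun u h => job_start (running (status_of tau M u h) i)) &
   forall i j, log_measurable (fun u h => job_query (running (status_of tau M u h) i) 0 j)].
Proof.
have S w : measurable_status (fun p : U * (size w).-tuple (n.-tuple R) =>
    status_of tau M p.1 (log_of p.2)).
  apply: (measurable_status_of_shape (w := w)) => //; first exact: measurable_log_of.
  by move=> -[u y]; rewrite unzip1_zip// size_map size_tuple.
split=> [w|i w|i w|i j w]; have [S1 S2] := S w => //.
- by have [] := S2 i.
- by have [] := S2 i.
- by have [] := S2 i.
Qed.

Section Output.
Context {d : measure_display} {X : measurableType d}.
Context (oracle : 'I_n -> 'rV[R]_n -> R -> 'rV[R]_n) (t : R).
Context (measurable_oracle : forall i (x : X -> 'rV[R]_n) (xi : X -> R),
  (forall j, measurable_fun setT (fun w => x w 0 j)) -> measurable_fun setT xi ->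
  forall j, measurable_fun setT (fun w => oracle i (x w) (xi w) 0 j)).
Context (u : X -> U) (z : X -> 'I_n -> nat -> R).
Context (mu : measurable_fun setT u) (mz : forall i k, measurable_fun setT (fun x => z x i k)).

Lemma measurable_plan H : measurable_log H ->
  measurable_jobs (fun x => plan tau M (u x) (H x)).
Proof.
move=> mH; apply: measurable_orders => //.
have [s1 s2 s3 s4] := log_measurable_status.
split; first exact: (measurable_log_apply s1).
move=> i; split => [||j].
- exact: (measurable_log_apply (s2 i)).
- exact: (measurable_log_apply (s3 i)).
- exact: (measurable_log_apply (s4 i j)).
Qed.

Lemma measurable_next_log H : measurable_log H ->
  measurable_log (fun x => if next_entry tau M oracle t (u x) (z x) (H x) is Some e
                           then e :: H x else H x).
Proof.
move=> mH; have mp := measurable_plan mH; have [m1 m2] := mH.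
set p := (fun x => plan tau M (u x) (H x)) in mp.
pose b i x := isSome (p x i) && (job_start (p x i) + tau i <= t).
have mb i : measurable_fun setT (b i).
  have [p1 p2 _] := mp i; apply: measurable_and => //.
  by apply: measurable_fun_ler => //; exact: measurable_funD.
(* All discrete data of one step: the next worker, the deadlines met, the workers so far. Where [g]
   is constant, the index of the sample read is a fixed number, so the new entry is a measurable
   expression. *)
pose g x := (Defs.next tau (p x), [ffun i => b i x], unzip1 (H x)).
have mg : discrete_measurable g.
  by apply: discrete_pair => //; apply: discrete_pair; [exact: discrete_next|exact: discrete_ffun].
pose who (c : option 'I_n * {ffun 'I_n -> bool} * seq 'I_n) :=
  if c.1.1 is Some i then if c.1.2 i then Some i else None else None.
have E x : next_entry tau M oracle t (u x) (z x) (H x) =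
    if who (g x) is Some i then
      Some (i, oracle i (job_query (p x i)) (z x i (count_mem i (unzip1 (H x)))))
    else None.
  rewrite /next_entry /who /g /= -/(p x); case: (Defs.next _ _) => [i|//].
  rewrite ffunE /b; case pxi: (p x i) => [[s q]|//] /=.
  by case: ifP => // _; rewrite /nreturned count_map pxi.
split=> [|k j].
  pose F c := if who c is Some i then i :: c.2 else c.2.
  rewrite (_ : (fun x => _) = fun x => F (g x)); first exact: (discrete_comp F mg).
  by apply/funext => x; rewrite E /F; case: (who _).
pose F := (fun c x => if who c is Some i then
   (if k is k'.+1 then nth 0 (unzip2 (H x)) k' 0 j
    else oracle i (job_query (p x i)) (z x i (count_mem i c.2)) 0 j)
   else nth 0 (unzip2 (H x)) k 0 j).
rewrite (_ : (fun x => _) = fun x => F (g x) x).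
  apply: (fiberwise_fun (F := F)) => // c; rewrite /F; case: (who c) => [i|]; last exact: m2.
  case: k {F} => [|k]; last exact: m2.
  apply: measurable_oracle; last exact: mz.
  by move=> l; have [_ _ mpt] := mp i; exact: mpt.
by apply/funext => x; rewrite E /F; case: (who _) => // i; case: k {F}.
Qed.

Lemma measurable_output_by j :
  measurable_fun setT (fun x => output_by tau M oracle t (u x) (z x) 0 j).
Proof.
apply: (measurable_log_apply (measurable_output M t j)) => //.
rewrite /log_by; elim: (\sum_i _)%N => [|m IH]; last exact: measurable_next_log.
split=> [|k l]; first exact: discrete_cst.
exact: (@measurable_cst _ _ X R setT (nth (0 : 'rV[R]_n) [::] k 0 l)).
Qed.

End Output.
End OutputMeasurable.

(** * Quadratic functions *)

Section Quadratic.
Context {R : realType} {n : nat}.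
Implicit Types x y v b : 'rV[R]_n.

Lemma dotC x y : dot x y = dot y x.
Proof. by apply: eq_bigr => j _; rewrite mulrC. Qed.

Lemma dotDl x y v : dot (x + y) v = dot x v + dot y v.
Proof. by rewrite /dot -big_split/=; apply: eq_bigr => j _; rewrite mxE mulrDl. Qed.

Lemma dotZl a x y : dot (a *: x) y = a * dot x y.
Proof. by rewrite /dot mulr_sumr; apply: eq_bigr => j _; rewrite mxE mulrA. Qed.

Lemma dotNl x y : dot (- x) y = - dot x y.
Proof. by rewrite -scaleN1r dotZl mulN1r. Qed.

Lemma dotDr x y v : dot v (x + y) = dot v x + dot v y.
Proof. by rewrite !(dotC v) dotDl. Qed.

Lemma dotZr a x y : dot x (a *: y) = a * dot x y.
Proof. by rewrite !(dotC x) dotZl. Qed.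

Lemma dotNr x y : dot x (- y) = - dot x y.
Proof. by rewrite !(dotC x) dotNl. Qed.

Definition dotE := (dotDl, dotZl, dotNl, dotDr, dotZr, dotNr).

Lemma dot_basis_vec x i : dot x (basis_vec i) = x 0 i.
Proof.
rewrite /dot (bigD1 i)//= mxE !eqxx mulr1 big1 ?addr0// => j ji.
by rewrite mxE (negbTE ji) andbF mulr0.
Qed.

Lemma enorm_sqr x : enorm x ^+ 2 = dot x x.
Proof. by rewrite sqr_sqrtr// sumr_ge0// => j _; rewrite -expr2 sqr_ge0. Qed.

Lemma dotxx_ge0 x : 0 <= dot x x.
Proof. by rewrite -enorm_sqr sqr_ge0. Qed.

Lemma dotxx_eq0 x : dot x x = 0 -> x = 0.
Proof.
move=> /eqP; rewrite psumr_eq0; last by move=> j _; rewrite -expr2 sqr_ge0.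
move=> /allP x0; apply/rowP => j; rewrite mxE.
by have := x0 j (mem_index_enum _); rewrite /= mulf_eq0 orbb => /eqP.
Qed.

Lemma enormZ a x : enorm (a *: x) = `|a| * enorm x.
Proof. by rewrite /enorm !dotE mulrA -expr2 sqrtrM ?sqr_ge0// sqrtr_sqr. Qed.

Lemma enorm0 : enorm (0 : 'rV[R]_n) = 0.
Proof. by rewrite -(scale0r 0) enormZ normr0 mul0r. Qed.

(** Common form of every [worker_fun] and of their average, so that calculus and minimization are
    done once for both. *)
Definition quad (m : R) b x : R := m / 2 * enorm x ^+ 2 - dot x b.

Lemma quad_expand m b x y :
  quad m b y = quad m b x + dot (m *: x - b) (y - x) + m / 2 * dot (y - x) (y - x).
Proof.
by rewrite /quad !enorm_sqr !dotE (dotC y x) (dotC b x) (dotC b y); field.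
Qed.

Lemma is_derive_coord j v x : is_derive x v (fun y : 'rV[R]_n => y 0 j : R) (v 0 j).
Proof.
have dc := @differentiable_coord R 1 n x 0 j.
apply: DeriveDef; first exact: diff_derivable.
apply: cvg_lim => //; apply: cvg_near_cst.
near=> h; have h0 : h != 0 by near: h; exact: nbhs_dnbhs_neq.
by rewrite /= !mxE addrK scalerA mulVf// scale1r.
Unshelve. all: by end_near. Qed.

Lemma quadE m b : quad m b =
  \sum_(j < n) ((m / 2) \*: ((fun y : 'rV[R]_n => y 0 j) ^+ 2) -
    b 0 j \*: (fun y : 'rV[R]_n => y 0 j)).
Proof.
apply/funext => x; rewrite /quad enorm_sqr /dot mulr_sumr -sumrB fct_sumE.
apply: eq_bigr => j _; transitivity (m / 2 * x 0 j ^+ 2 - b 0 j * x 0 j); [by ring|by []].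
Qed.

Lemma differentiable_quad m b x : differentiable (quad m b) x.
Proof.
rewrite quadE; apply: differentiable_sum => j.
apply: differentiableB; apply: differentiableZ; last exact: differentiable_coord.
by apply: differentiableX; exact: differentiable_coord.
Qed.

Lemma gradient_quad m b x : gradient (quad m b) x = m *: x - b.
Proof.
apply/rowP => i; rewrite !mxE; apply: derive_val.
rewrite quadE; apply: is_derive_eq.
  apply: is_derive_sum => j; apply: is_deriveB; apply: is_deriveZ.
    by apply: is_deriveX; exact: is_derive_coord.
  exact: is_derive_coord.
rewrite (bigD1 i)//= big1 ?addr0.
  by rewrite !mxE !eqxx !scaler1 /=; rewrite /GRing.scale /=; field.
by move=> j ji; rewrite !mxE (negbTE ji) andbF !scaler0 subr0.
Qed.

Lemma smooth_quad m b : smooth (quad m b).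
Proof.
split; first exact: differentiable_quad.
exists `|m| => x y; rewrite !gradient_quad opprB addrA addrNK -scalerBr.
by rewrite enormZ.
Qed.

Lemma differentiable_gradient_quad m b x : differentiable (gradient (quad m b)) x.
Proof.
rewrite (_ : gradient _ = ( *:%R m) - cst b); last first.
  by apply/funext => y; rewrite gradient_quad.
by apply: differentiableB.
Qed.

Lemma hessian_quad m b x : hessian (quad m b) x = m%:M.
Proof.
rewrite /hessian /jacobian (_ : gradient _ = ( *:%R m) - cst b); last first.
  by apply/funext => y; rewrite gradient_quad.
have D : is_diff x (( *:%R m) - cst b : 'rV[R]_n -> 'rV[R]_n) (( *:%R m) - 0).
  exact: is_diffB.
apply/matrixP => i j; rewrite [LHS]mxE.
rewrite diff_val subr0 !mxE.
by rewrite eqxx /= mulr_natr eq_sym.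
Qed.

Lemma convex_quad m b : 0 <= m -> convex (quad m b).
Proof.
move=> m0 t x y _ _.
have u0 : 0 <= t%:inum :> R by [].
have u1 : t%:inum <= 1 :> R by [].
move: u0 u1; set u : R := t%:inum => u0 u1.
rewrite -[X in _ <= X]/(u * quad m b x + (1 - u) * quad m b y).
rewrite -[X in quad m b X <= _]/(u *: (x : 'rV[R]_n) + (1 - u) *: (y : 'rV[R]_n)).
rewrite -subr_ge0 (_ : _ - _ = m / 2 * (u * (1 - u)) *
    dot ((x : 'rV[R]_n) - y) ((x : 'rV[R]_n) - y)).
  by rewrite !mulr_ge0 ?dotxx_ge0// subr_ge0.
by rewrite /quad !enorm_sqr !dotE (dotC y x); field.
Qed.

Lemma quad_minimum m b y : m != 0 ->
  quad m b y = quad m b (m^-1 *: b) + m / 2 * dot (y - m^-1 *: b) (y - m^-1 *: b).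
Proof.
move=> m0; rewrite (quad_expand m b (m^-1 *: b) y) scalerA divff// scale1r subrr.
by rewrite -[X in dot X _](scale0r b) dotZl mul0r addr0.
Qed.

Lemma is_minimizer_quad m b : 0 < m -> is_minimizer (quad m b) (m^-1 *: b).
Proof.
move=> m0 y; rewrite (quad_minimum b y)// ?gt_eqF// lerDl mulr_ge0 ?dotxx_ge0//.
by rewrite divr_ge0// ltW.
Qed.

Lemma unique_minimizer_quad m b : 0 < m -> unique (is_minimizer (quad m b)) (m^-1 *: b).
Proof.
move=> m0; split; first exact: is_minimizer_quad.
move=> y ymin; have := ymin (m^-1 *: b).
rewrite (quad_minimum b y) ?gt_eqF// gerDl pmulr_rle0 ?divr_gt0// => le0.
have := @dotxx_eq0 (y - m^-1 *: b).
rewrite (@le_anti _ _ _ 0 (introT andP (conj le0 (dotxx_ge0 _)))) => /(_ erefl) /eqP.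
by rewrite subr_eq0 => /eqP.
Qed.

Lemma polyak_lojasiewicz_quad m b : 0 < m -> polyak_lojasiewicz m (quad m b).
Proof.
move=> m0; have lb : lbound (range (quad m b)) (quad m b (m^-1 *: b)).
  by move=> _ [y _ <-]; exact: is_minimizer_quad.
have hi : has_inf (range (quad m b)).
  by split; [exists (quad m b 0), 0|exists (quad m b (m^-1 *: b))].
have infE : inf (range (quad m b)) = quad m b (m^-1 *: b).
  apply/eqP; rewrite eq_le; apply/andP; split.
    by apply: ge_inf; [case: hi|exists (m^-1 *: b)].
  by apply: lb_le_inf => //; case: hi.
split=> // x; rewrite infE gradient_quad enorm_sqr (quad_minimum b x) ?gt_eqF//.
(* Equality holds: both sides are [m ^+ 2] times the squared distance to the minimizer. *)
rewrite le_eqVlt; apply/orP; left; apply/eqP.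
have -> : m *: x - b = m *: (x - m^-1 *: b).
  by rewrite scalerBr scalerA divff ?gt_eqF// scale1r.
by rewrite addrAC subrr add0r dotZl dotZr; field.
Qed.

End Quadratic.

(** * Number of samples read by time t *)

Section Locality.
Context {R : realType} {n : nat} (tau : 'I_n -> R) (tau_gt0 : forall i, 0 < tau i).
Context {dU : measure_display} {U : measurableType dU} (M : method R n U) (t : R) (u : U).

(* The invariant bounds the number of gradients worker i returns by time t by
   the truncation of t / tau i, so that later samples are never read. *)
Definition consistent_times (h : log R n) := let st := status_of tau M u h in
  [/\ forall i, (nreturned h i)%:R * tau i <= clock st,
      forall i s x, running st i = Some (s, x) -> (nreturned h i)%:R * tau i <= s
    & forall i s x, running st i = Some (s, x) -> clock st <= s + tau i].

Lemma consistent_plan h i s x : consistent_times h ->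
  plan tau M u h i = Some (s, x) ->
  (nreturned h i)%:R * tau i <= s /\ clock (status_of tau M u h) <= s + tau i.
Proof.
move=> [Hc Hs Hr]; rewrite /plan /orders; case: ifP => _.
  move=> [<- _]; have := delay_ge0 M u h i; have := Hc i; have := tau_gt0 i.
  by split; lra.
by move=> run; split; [exact: Hs run|exact: Hr run].
Qed.

(** The returning job has the smallest finish time, so the new clock overtakes no job that stays,
    and the count of a worker grows only when its own job of length [tau i] ends. *)
Lemma consistent_cons h i g : consistent_times h ->
  Defs.next tau (plan tau M u h) = Some i -> consistent_times ((i, g) :: h).
Proof.
move=> Hh; have planP j s x := consistent_plan (i := j) (s := s) (x := x) Hh.
rewrite /consistent_times /= /advance -/(plan tau M u h) => nextE; rewrite nextE /=.
move: nextE; rewrite /Defs.next; case: pickP => // k /andP[fin /forallP kmin] [ki].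
rewrite ki in fin kmin; have [s [x pi]] : exists s x, plan tau M u h i = Some (s, x).
  by move: fin; rewrite /finish; case: (plan _ _ _ _ _) => // -[s x] _; exists s, x.
have finE : finish tau (plan tau M u h) i = (s + tau i)%:E by rewrite /finish pi.
have [ci cs] := planP _ _ _ pi; have [Hc _ _] := Hh.
rewrite finE /=; split=> [j|j s' x'|j s' x'].
- case: eqVneq => [<-|_] /=; first by rewrite natrD; lra.
  by rewrite add0n; exact: le_trans (Hc j) cs.
- case pj: (plan tau M u h j) => [[s1 x1]|//].
  case: ifP => // /andP[ji _] [<- _]; rewrite eq_sym (negbTE ji) add0n.
  by have [] := planP _ _ _ pj.
- case pj: (plan tau M u h j) => [[s1 x1]|//].
  case: ifP => // _ [<- _]; have := kmin j.
  by rewrite finE /finish pj lee_fin.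
Qed.

Lemma output_by_eq (oracle oracle' : 'I_n -> 'rV[R]_n -> R -> 'rV[R]_n)
    (z z' : 'I_n -> nat -> R) :
  (forall i x k, (k < Num.truncn (t / tau i))%N -> oracle i x (z i k) = oracle' i x (z' i k)) ->
  output_by tau M oracle t u z = output_by tau M oracle' t u z'.
Proof.
move=> same; rewrite /output_by /log_by; congr output.
move: (\sum_i _)%N => m.
suff [] : entries tau M oracle t u z m = entries tau M oracle' t u z' m /\
    consistent_times (entries tau M oracle t u z m) by [].
elim: m => [|m [IH Hh]] /=.
  by split=> //; split=> // i; rewrite mul0r.
rewrite -IH; set h := entries _ _ _ _ _ _ _ in Hh *.
rewrite /next_entry; case nextE: Defs.next => [i|]; last by split.
case pi: (plan tau M u h i) => [[s x]|]; last by split.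
case: ifP => st; last by split.
have [ci _] := consistent_plan Hh pi.
rewrite same; last first.
  (* A return by time [t] gives [(1 + nreturned h i) * tau i <= s + tau i <= t], so the sample
     index, counted from 0, lies strictly below the truncation. *)
  have bnd : (1 + nreturned h i)%:R <= t / tau i.
    by rewrite ler_pdivlMr// natrD; lra.
  by rewrite -[_.+1]add1n -(@natrK R (1 + _)) le_truncn.
by split=> //; exact: consistent_cons.
Qed.

End Locality.

(** * The hard instance and averaging over sign vectors *)

Section Instance.
Context {R : realType} {n : nat}.

Lemma worker_funE (mu beta : R) (phi : 'I_n -> R) i :
  worker_fun mu beta phi i = quad mu ((beta * phi i) *: basis_vec i).
Proof. by apply/funext => x; rewrite /worker_fun /quad dotZr mulrA. Qed.

Lemma average_worker_funE (mu beta : R) (phi : 'I_n -> R) : (0 < n)%N ->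
  average (worker_fun mu beta phi) = quad mu ((beta / n%:R) *: \row_j phi j).
Proof.
move=> n0; have n0' : n%:R != 0 :> R by rewrite pnatr_eq0 -lt0n.
apply/funext => x; rewrite /average /quad /worker_fun sumrB sumr_const card_ord mulrBr.
congr (_ - _); first by rewrite -[X in _ * X]mulr_natl mulKf.
rewrite mulr_sumr dotZr [in RHS]/dot mulr_sumr; apply: eq_bigr => i _.
by rewrite mxE dot_basis_vec; ring.
Qed.

(* A method sees phi only through the shifted samples xi - beta * phi i. *)
Definition base_oracle (mu : R) (i : 'I_n) (x : 'rV[R]_n) (y : R) : 'rV[R]_n :=
  mu *: x + y *: basis_vec i.

Lemma stoch_grad_worker (mu beta : R) (phi : 'I_n -> R) i x xi :
  stoch_grad (worker_fun mu beta phi) i x xi = base_oracle mu i x (xi - beta * phi i).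
Proof.
by rewrite /stoch_grad worker_funE gradient_quad /base_oracle scalerBl addrAC addrA.
Qed.

Definition flip (e : {ffun 'I_n -> bool}) (i : 'I_n) : {ffun 'I_n -> bool} :=
  [ffun j => (j == i) (+) e j].

Lemma flipK i : involutive (flip^~ i).
Proof. by move=> e; apply/ffunP => j; rewrite !ffunE addbA addbb. Qed.

(** Both hypotheses are summed over all [e]. Flipping coordinate [i] permutes the sign vectors, so
    the two risks at [i] have the same total, whence the factor 2. *)
Lemma assouad (r : 'I_n -> {ffun 'I_n -> bool} -> R) (a : 'I_n -> R) (eps : R) :
  (forall e, \sum_i r i e <= eps) ->
  (forall i e, a i <= r i e + r i (flip e i)) ->
  \sum_i a i <= 2 * eps.
Proof.
move=> re ae; set N := #|{ffun 'I_n -> bool}|.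
have N0 : (0 < N)%N by rewrite /N card_ffun card_bool expn_gt0.
rewrite -(ler_pM2l (x := N%:R)) ?ltr0n//.
apply: (@le_trans _ _ (\sum_i \sum_e (r i e + r i (flip e i)))).
  rewrite mulr_sumr; apply: ler_sum => i _.
  by rewrite mulr_natl -sumr_const; apply: ler_sum => e _.
rewrite (eq_bigr (fun i => 2 * \sum_e r i e)) => [|i _]; last first.
  have flipE : \sum_e r i (flip e i) = \sum_e r i e.
    by rewrite [RHS](reindex_inj (inv_inj (flipK i))).
  by rewrite big_split/= flipE mulr_natl.
rewrite -mulr_sumr exchange_big/= mulrCA ler_pM2l//.
by rewrite mulr_natl -sumr_const; apply: ler_sum => e _.
Qed.

End Instance.

(** * Mean and variance of the stochastic gradients *)

Section Noise.
Context {R : realType} {n : nat} {d : measure_display} {Omega : measurableType d}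
  (P : probability Omega R) (sigma : R) (noise : 'I_n -> nat -> {RV P >-> R}).
Context (normal : normal_noise sigma noise) (sigma0 : sigma != 0).

(* [noise i k] with values in R seen with the sigma-algebra of Lebesgue measure,
   convertible to, but not the same structure as, the default one on R *)
Let noise_lebesgue i k : Omega -> measurableTypeR R := noise i k.

Let measurable_noise i k : measurable_fun setT (noise_lebesgue i k).
Proof. exact: (measurable_funPT (noise i k)). Qed.

Lemma ge0_integral_noise i k (f : R -> \bar R) :
  measurable_fun setT f -> (forall y, 0 <= f y)%E ->
  (\int[P]_w f (noise i k w) = \int[normal_prob 0 sigma]_y f y)%E.
Proof.
move=> mf f0.
rewrite -[LHS](@ge0_integral_pushforward _ _ _ _ _ _ (measurable_noise i k) P setT f)//.
apply: eq_measure_integral => B mB _.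
exact: normal.
Qed.

Lemma integral_noise i k (f : R -> \bar R) :
  (normal_prob 0 sigma).-integrable setT f ->
  P.-integrable setT (fun w => f (noise i k w)) /\
  (\int[P]_w f (noise i k w) = \int[normal_prob 0 sigma]_y f y)%E.
Proof.
move=> fi; have mf := measurable_int _ fi.
have mfn : measurable_fun setT (f \o noise_lebesgue i k).
  exact: (measurableT_comp mf (measurable_noise i k)).
have fPi : P.-integrable setT (f \o noise_lebesgue i k).
  apply/integrableP; split; first exact: mfn.
  rewrite (ge0_integral_noise i k (f := fun y => `|f y|%E))//; last first.
    exact: (measurableT_comp (@abse_measurable _ setT) mf).
  by case/integrableP : fi.
split; first exact: fPi.
rewrite -[LHS](integral_pushforward (measurable_noise i k) (D := setT))//.
apply: eq_measure_integral => B mB _.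
exact: normal.
Qed.

Lemma unbiased_stoch_grad (f : 'I_n -> 'rV[R]_n -> R) :
  unbiased_variance_bounded f sigma noise.
Proof.
move=> i k x.
have [ni nE] := integral_noise i k (integrable_normal_id sigma0).
have n0 : (\int[P]_w (noise i k w)%:E = 0)%E by rewrite nE normal_mean.
split=> [j|].
  rewrite expectation.unlock.
  under eq_integral => w _ do
    rewrite /stoch_grad mxE [X in _ + X]mxE EFinD (mulrC (noise i k w)) EFinM.
  rewrite integralD//; last 2 first.
  - exact: finite_measure_integrable_cst.
  - exact: integrableZl.
  rewrite integral_cst// [X in (_ * X)%E](_ : _ = 1%E) ?mule1; last exact: probability_setT.
  by rewrite integralZl// n0 mule0 adde0.
rewrite expectation.unlock.
rewrite (eq_integral (fun w => ((noise i k w) ^+ 2)%:E)); last first.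
  move=> w _; congr (_%:E).
  by rewrite /stoch_grad addrAC subrr add0r enorm_sqr dotZl dotZr dot_basis_vec mxE !eqxx mulr1.
rewrite (ge0_integral_noise i k (f := fun y => (y ^+ 2)%:E)).
- exact: normal_second_moment_le.
- by apply/measurable_EFinP; exact: measurable_funX.
- by move=> y; rewrite lee_fin sqr_ge0.
Qed.

End Noise.

(** * Lower bound on the risk *)

Section LowerBound.
Context {R : realType} {n : nat} (tau : 'I_n -> R) (tau_gt0 : forall i, 0 < tau i).
Context {dU : measure_display} {U : measurableType dU} (M : method R n U)
  {d : measure_display} {Omega : measurableType d} (P : probability Omega R)
  (seed : {RV P >-> U}) (noise : 'I_n -> nat -> {RV P >-> R}).
Context (sigma mu beta t : R).
Context (normal : normal_noise sigma noise) (indep : independent_samples seed noise).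
Context (sigma_gt0 : 0 < sigma).

Definition noisy_output (phi : 'I_n -> R) (w : Omega) : 'rV[R]_n :=
  output_by tau M (stoch_grad (worker_fun mu beta phi)) t (seed w) (fun i k => noise i k w).

Definition path_output (j : 'I_n) (p : @paths R n dU U) : R :=
  output_by tau M (base_oracle mu) t p.1 p.2 0 j.

Lemma measurable_path_output j : measurable_fun setT (path_output j).
Proof.
apply: measurable_output_by.
- move=> i x xi mx mxi l; rewrite /base_oracle.
  rewrite (_ : (fun w => _) = fun w => mu * x w 0 l + xi w * basis_vec i 0 l).
    by apply: measurable_funD; apply: measurable_funM.
  by apply/funext => w; rewrite !mxE.
- exact: measurable_path_seed.
- by move=> i k; exact: measurable_path_noise.
Qed.

Definition shift_all (b : 'I_n -> R) (p : @paths R n dU U) : @paths R n dU U :=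
  (p.1, fun i k => p.2 i k + b i).

Lemma measurable_shift_all b : measurable_fun setT (shift_all b).
Proof.
apply: measurable_fun_path => [|i k]; first exact: measurable_path_seed.
by apply: measurable_funD => //; exact: measurable_path_noise.
Qed.

Lemma noisy_outputE (phi : 'I_n -> R) w j :
  noisy_output phi w 0 j =
  path_output j (shift_all (fun i => - (beta * phi i)) (path_of seed noise w)).
Proof.
rewrite /noisy_output /path_output; congr (fun_of_matrix _ 0 j).
apply: (output_by_eq tau_gt0) => // i x k _.
by rewrite stoch_grad_worker.
Qed.

(** The shift of worker [i] is cut to the samples that can be returned by time [t], so that it has a
    likelihood ratio. The shifts of the other workers remain a mere measurable map, to be absorbed
    into the estimator. *)
Lemma noisy_outputE_first (phi : 'I_n -> R) w i :
  noisy_output phi w 0 i = path_output i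
    (shift_all (fun j => if j == i then 0 else - (beta * phi j))
       (shift_first i (Num.truncn (t / tau i)) (- (beta * phi i)) (path_of seed noise w))).
Proof.
rewrite noisy_outputE /path_output; congr (fun_of_matrix _ 0 i).
apply: (output_by_eq tau_gt0) => // j x k kN /=.
by have [ji|ji] := eqVneq j i; rewrite /= ?addr0 // -ji kN.
Qed.

Definition signed (s : 'I_n -> R) (e : {ffun 'I_n -> bool}) (i : 'I_n) : R :=
  if e i then - s i else s i.

Lemma coordinate_lower_bound (s : 'I_n -> R) (e : {ffun 'I_n -> bool}) (kappa : R) i :
  0 <= s i -> 0 <= kappa ->
  2 * expR ((Num.truncn (t / tau i))%:R * ((beta * s i) ^+ 2 / sigma ^+ 2)) <= 3 ->
  (((kappa * s i) ^+ 2)%:E <=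
   \int[P]_w ((noisy_output (signed s e) w 0 i - kappa * signed s e i) ^+ 2)%:E +
   \int[P]_w ((noisy_output (signed s (flip e i)) w 0 i -
     kappa * signed s (flip e i) i) ^+ 2)%:E)%E.
Proof.
move=> s0 kappa0 hN.
wlog ei : e / e i = false.
  move=> H; case ei: (e i); last exact: H.
  have := H (flip e i); rewrite ffunE eqxx ei => /(_ erefl).
  by rewrite flipK addeC.
(* Flipping coordinate [i] changes no other sign, so both outputs are the same [h] at opposite
   shifts of the samples of worker [i]. *)
set h := fun p => path_output i
  (shift_all (fun j => if j == i then 0 else - (beta * signed s e j)) p).
have mh : measurable_fun setT h.
  exact: (measurableT_comp (measurable_path_output i) (measurable_shift_all _)).
have s_ei : signed s e i = s i by rewrite /signed ei.
have s_fi : signed s (flip e i) i = - s i by rewrite /signed ffunE eqxx ei.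
have E1 w : noisy_output (signed s e) w 0 i =
    h (shift_first i (Num.truncn (t / tau i)) (- (beta * s i)) (path_of seed noise w)).
  by rewrite noisy_outputE_first s_ei.
have E2 w : noisy_output (signed s (flip e i)) w 0 i =
    h (shift_first i (Num.truncn (t / tau i)) (- - (beta * s i)) (path_of seed noise w)).
  rewrite noisy_outputE_first s_fi mulrN /h; congr (path_output i (shift_all _ _)).
  by apply/funext => j; case: eqVneq => // ji; rewrite /signed ffunE (negbTE ji).
under eq_integral do rewrite E1 s_ei.
under [X in (_ <= _ + X)%E]eq_integral do rewrite E2 s_fi mulrN (opprK (kappa * s i)).
apply: (two_point_lower_bound normal indep _ i mh); rewrite ?gt_eqF ?mulr_ge0//.
by rewrite sqrrN.
Qed.

Lemma risk_lower_bound (s : 'I_n -> R) (kappa eps : R) :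
  (forall i, 0 <= s i) -> 0 <= kappa ->
  (forall i, 2 * expR ((Num.truncn (t / tau i))%:R * ((beta * s i) ^+ 2 / sigma ^+ 2)) <= 3) ->
  2 * eps < \sum_i (kappa * s i) ^+ 2 ->
  exists e : {ffun 'I_n -> bool},
    ~ ('E_P[(fun w => enorm (noisy_output (signed s e) w -
      kappa *: \row_j signed s e j) ^+ 2)%R] <= eps%:E)%E.
Proof.
move=> s0 kappa0 hN lb; apply: contrapT => /forallNP small.
have {}small e : ('E_P[(fun w => enorm (noisy_output (signed s e) w -
    kappa *: \row_j signed s e j) ^+ 2)%R] <= eps%:E)%E.
  by apply: contrapT; exact: small.
pose I i e := (\int[P]_w ((noisy_output (signed s e) w 0 i - kappa * signed s e i) ^+ 2)%:E)%E.
have I0 i e : (0 <= I i e)%E by apply: integral_ge0 => w _; rewrite lee_fin sqr_ge0.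
have sumI e : (\sum_i I i e <= eps%:E)%E.
  pose sq i w := ((noisy_output (signed s e) w 0 i - kappa * signed s e i) ^+ 2)%:E.
  apply: le_trans (small e); rewrite expectation.unlock.
  rewrite (_ : (\sum_i I i e)%E = (\int[P]_w (\sum_i sq i w)%E)%E); last first.
    symmetry; apply: ge0_integral_sum => //.
    - move=> i; apply/measurable_EFinP; apply: measurable_funX; apply: measurable_funB => //.
      rewrite (_ : (fun w => _) =
        (path_output i \o shift_all (fun j => - (beta * signed s e j))) \o path_of seed noise).
        apply: measurableT_comp; last exact: measurable_path_of.
        apply: measurableT_comp; [exact: measurable_path_output|exact: measurable_shift_all].
      by apply/funext => w; rewrite /= -noisy_outputE.
    - by move=> i w _; rewrite lee_fin sqr_ge0.
  rewrite le_eqVlt; apply/orP; left; apply/eqP; apply: eq_integral => w _.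
  rewrite sumEFin enorm_sqr /dot; congr (_%:E); apply: eq_bigr => i _.
  by rewrite !mxE -expr2.
(* The bound assumed on the total risk makes each coordinate risk finite, so the averaging can take
   place in the reals. *)
have Ifin i e : I i e \is a fin_num.
  rewrite ge0_fin_numE//; apply: le_lt_trans (ltry eps); apply: le_trans (sumI e).
  rewrite (bigD1 i)//= leeDl// sume_ge0//.
have := @assouad R n (fun i e => fine (I i e)) (fun i => (kappa * s i) ^+ 2) eps.
rewrite leNgt lb => H; suff : false by []; apply: H => [e|i e].
  rewrite -lee_fin -sumEFin; under eq_bigr do rewrite fineK//.
  exact: sumI.
rewrite -lee_fin EFinD !fineK//; exact: coordinate_lower_bound.
Qed.

End LowerBound.

(** * Constants, amplitudes and verification of the instance *)

Lemma expR_third (R : realType) (x : R) : x <= 3^-1 -> 2 * expR x <= 3.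
Proof.
move=> x3; have : expR x <= expR 3^-1 by rewrite ler_expR.
have := expR_ge1Dx (- 3^-1 : R); rewrite expRN; set e := expR 3^-1 => h.
have e0 : 0 < e by exact: expR_gt0.
have : (1 - 3^-1) * e <= 1 by rewrite -ler_pdivlMr// div1r.
lra.
Qed.

Theorem theorem2p3 (R : realType) :
  exists c c0 : R, 0 < c /\ 0 < c0 /\
  forall (n : nat) (tau : 'I_n -> R) (radius mu beta sigma eps : R),
  (0 < n)%N ->
  (forall i, 0 < tau i) ->
  (forall i j : 'I_n, (i <= j)%N -> tau i <= tau j) ->
  0 < radius -> 0 < mu -> 0 < beta -> 0 < sigma -> 0 < eps ->
  eps <= c * beta ^+ 2 / (mu ^+ 2 * n%:R ^+ 2) ->
  beta ^+ 2 / (mu ^+ 2 * n%:R) <= radius ^+ 2 ->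
  forall (dU : measure_display) (U : measurableType dU) (M : method R n U)
    (d : measure_display) (Omega : measurableType d)
    (P : probability Omega R) (seed : {RV P >-> U})
    (noise : 'I_n -> nat -> {RV P >-> R}),
  normal_noise sigma noise ->
  independent_samples seed noise ->
  forall t : R,
  t <= c0 * (n%:R^-1 * \sum_(i < n) tau i)
       * (sigma ^+ 2 / (n%:R * mu ^+ 2 * eps)) ->
  exists phi : 'I_n -> R, (forall i, -1 <= phi i <= 1) /\
  let fi := worker_fun mu beta phi in
  let f := average fi in
  let x0 : 'rV[R]_n := 0 in
  let delta1 := 2 * beta ^+ 2 in
  let delta2 : R := 0 in
  [/\ smooth f /\ (forall i, smooth (fi i)),
      (forall i, convex (fi i)),
      (exists x, is_minimizer f x),
      unbiased_variance_bounded fi sigma noise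
    & polyak_lojasiewicz mu f] /\
  (forall i j x,
     enorm (gradient (fi i) x - gradient (fi j) x) ^+ 2 <= delta1) /\
  (forall i x, differentiable (gradient (fi i)) x) /\
  (forall i j x, opnorm (hessian (fi i) x - hessian (fi j) x) ^+ 2 <= delta2) /\
  exists xs : 'rV[R]_n, unique (is_minimizer f) xs /\
  enorm (x0 - xs) ^+ 2 <= radius ^+ 2 /\
  ~ ('E_P[(fun w => enorm (output_by tau M (stoch_grad fi) t (seed w)
                             (fun i k => noise i k w) - xs) ^+ 2)%R]
     <= eps%:E)%E.
Proof.
(* Both constants come from requiring [kappa ^+ 2 * \sum_i v i >= 3 * eps], a margin over the strict
   bound [2 * eps]. The first serves the case of an amplitude equal to 1; in the other case the
   factor 1/3 inside [v] turns 1/3 into 1/9. *)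
exists 3^-1, 9^-1; split; [lra|split; [lra|]].
move=> n tau radius mu beta sigma eps n_gt0 tau_gt0 _ _ mu_gt0 beta_gt0 sigma_gt0 eps_gt0.
move=> eps_le radius_ge dU U M d Omega P seed noise normal indep t t_le.
have nR : 0 < n%:R :> R by rewrite ltr0n.
have n0 : n%:R != 0 :> R by rewrite gt_eqF.
have mu0 : mu != 0 by rewrite gt_eqF.
have b2 : 0 < beta ^+ 2 by rewrite exprn_gt0.
have s2 : 0 < sigma ^+ 2 by rewrite exprn_gt0.
have m2 : 0 < mu ^+ 2 by rewrite exprn_gt0.
(* v i is the square of the amplitude of phi i: as large as possible with the
   samples of worker i unable to reveal the sign of phi i *)
pose v i : R := if t <= 0 then 1 else Num.min 1 (sigma ^+ 2 * tau i / (3 * beta ^+ 2 * t)).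
have v01 i : 0 <= v i <= 1.
  rewrite /v; case: (lerP t 0) => t0; first by rewrite ler01 lexx.
  rewrite ge_min lexx /= andbT le_min ler01 /= divr_ge0//; first by rewrite mulr_ge0// ltW.
  by rewrite !mulr_ge0// ltW.
pose s i := Num.sqrt (v i).
have s0 i : 0 <= s i by exact: sqrtr_ge0.
have sv i : s i ^+ 2 = v i by rewrite sqr_sqrtr//; case/andP: (v01 i).
have s1 i : s i <= 1 by rewrite -sqrtr1 ler_wsqrtr//; case/andP: (v01 i).
pose kappa := mu^-1 * (beta / n%:R).
have kappa0 : 0 <= kappa by rewrite mulr_ge0 ?invr_ge0 ?divr_ge0// ltW.
have samples i : 2 * expR ((Num.truncn (t / tau i))%:R * ((beta * s i) ^+ 2 / sigma ^+ 2)) <= 3.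
  apply: expR_third; rewrite exprMn sv /v.
  have [t0|t0] := lerP t 0.
    (* By a nonpositive time no gradient is returned, so the full amplitude is allowed. *)
    rewrite (_ : Num.truncn _ = 0%N) ?mul0r ?invr_ge0//.
    apply/truncn0Pn; rewrite -ltNge.
    by apply: (@le_lt_trans _ _ 0) => //; rewrite pmulr_lle0// invr_gt0.
  set N := (Num.truncn _)%:R.
  have N_le : N <= t / tau i.
    by rewrite /N truncn_le// divr_ge0// ltW.
  set m := Num.min _ _.
  have m_le : m <= sigma ^+ 2 * tau i / (3 * beta ^+ 2 * t) by rewrite ge_min lexx orbT.
  have m_ge : 0 <= m by have := v01 i; rewrite /v (lt_geF t0) => /andP[].
  apply: (@le_trans _ _ (t / tau i *
    (beta ^+ 2 * (sigma ^+ 2 * tau i / (3 * beta ^+ 2 * t)) / sigma ^+ 2))).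
    apply: ler_pM => //; first by rewrite mulr_ge0 ?invr_ge0 ?mulr_ge0// ltW.
    by rewrite ler_wpM2r ?invr_ge0 ?(ltW s2)// ler_wpM2l// ltW.
  rewrite le_eqVlt; apply/orP; left; apply/eqP.
  by field; rewrite !gt_eqF.
have eps3 : 3 * eps * (mu ^+ 2 * n%:R ^+ 2) <= beta ^+ 2.
  move: eps_le; rewrite ler_pdivlMr ?mulr_gt0 ?exprn_gt0//; lra.
have kappaE : kappa ^+ 2 * (mu ^+ 2 * n%:R ^+ 2) = beta ^+ 2.
  by rewrite /kappa; field; rewrite n0 mu0.
have lb : 2 * eps < \sum_i (kappa * s i) ^+ 2.
  under eq_bigr do rewrite exprMn sv.
  rewrite -mulr_sumr.
  have Q : 0 < mu ^+ 2 * n%:R ^+ 2 by rewrite mulr_gt0// exprn_gt0.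
  rewrite -(ltr_pM2r Q) [ltRHS]mulrAC kappaE.
  apply: (@lt_le_trans _ _ (3 * eps * (mu ^+ 2 * n%:R ^+ 2))).
    by rewrite ltr_pM2r// ltr_pM2r//; lra.
  (* A single worker with [v i = 1] already contributes [kappa ^+ 2 >= 3 * eps]. Otherwise each
     minimum is its second argument, linear in [tau i], which is how the mean of the computation
     times enters. *)
  have [[i vi]|small] := pselect (exists i, v i = 1).
    apply: le_trans eps3 _; rewrite ler_peMr ?(ltW b2)// (bigD1 i)//= vi lerDl.
    by apply: sumr_ge0 => j _; case/andP: (v01 j).
  have t_gt0 : 0 < t.
    rewrite ltNge; apply/negP => t0; apply: small; exists (Ordinal n_gt0).
    by rewrite /v t0.
  rewrite (eq_bigr (fun i => sigma ^+ 2 / (3 * beta ^+ 2 * t) * tau i)); last first.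
    move=> i _; have vi : v i <> 1 by move=> vi; apply: small; exists i.
    move: vi; rewrite /v (lt_geF t_gt0) /Num.min; case: ifP => // _ _.
    by rewrite mulrAC.
  rewrite -mulr_sumr; set T := \sum_i tau i in t_le *.
  have -> : beta ^+ 2 * (sigma ^+ 2 / (3 * beta ^+ 2 * t) * T) = sigma ^+ 2 * T / (3 * t).
    by field; rewrite !gt_eqF.
  rewrite ler_pdivlMr ?mulr_gt0//.
  have : t * (n%:R ^+ 2 * mu ^+ 2 * eps) <= 9^-1 * T * sigma ^+ 2.
    rewrite -ler_pdivlMr ?mulr_gt0 ?exprn_gt0//; apply: le_trans t_le _.
    rewrite le_eqVlt; apply/orP; left; apply/eqP.
    by field; rewrite mu0 n0 gt_eqF.
  lra.
have [e he] := risk_lower_bound tau_gt0 M mu normal indep sigma_gt0 s0 kappa0 samples lb.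
pose phi := signed s e.
have phi2 i : phi i ^+ 2 = v i by rewrite /phi /signed; case: ifP => _; rewrite ?sqrrN sv.
exists phi; split.
  by move=> i; rewrite /phi /signed; have := s0 i; have := s1 i; case: ifP => _; lra.
move=> fi f x0 delta1 delta2.
have fiE i : fi i = quad mu ((beta * phi i) *: basis_vec i) by exact: worker_funE.
have fE : f = quad mu ((beta / n%:R) *: \row_j phi j) by exact: average_worker_funE.
split; first split.
- by rewrite fE; split; [exact: smooth_quad|move=> i; rewrite fiE; exact: smooth_quad].
- by move=> i; rewrite fiE; apply: convex_quad; exact: ltW.
- by rewrite fE; eexists; exact: is_minimizer_quad.
- by apply: unbiased_stoch_grad => //; rewrite gt_eqF.
- by rewrite fE; exact: polyak_lojasiewicz_quad.
split.
  move=> i j x; rewrite !fiE !gradient_quad enorm_sqr.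
  rewrite opprB (addrC (mu *: x - _)) addrA addrNK.
  have vb k : 0 <= phi k ^+ 2 <= 1 by rewrite phi2.
  have [->|ij] := eqVneq i j.
    by rewrite subrr -[X in dot X _](scale0r x) dotZl mul0r /delta1 mulr_ge0// ltW.
  rewrite !dotE !dot_basis_vec !mxE !eqxx (negbTE ij) eq_sym (negbTE ij) /=.
  rewrite /delta1; have /andP[_ hi] := vb i; have /andP[_ hj] := vb j; nra.
split; first by move=> i x; rewrite fiE; exact: differentiable_gradient_quad.
split.
  move=> i j x; rewrite !fiE !hessian_quad subrr /opnorm.
  rewrite (_ : [set _ | _ in _] = [set 0]) ?sup1 ?expr0n//=.
  apply/seteqP; split=> y /=.
    by move=> [u _ <-]; rewrite mulmx0 enorm0.
  by move=> ->; exists 0; rewrite ?mulmx0 enorm0 ?ler01.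
exists (kappa *: \row_j phi j); split; [|split].
- by rewrite fE /kappa -(scalerA mu^-1); exact: unique_minimizer_quad.
(* The squared norm of the minimizer is [kappa ^+ 2 * \sum_i v i], at most [kappa ^+ 2 * n%:R],
   which is [beta ^+ 2 / (mu ^+ 2 * n%:R)]. *)
- apply: le_trans radius_ge; rewrite enorm_sqr sub0r !dotE.
  rewrite (_ : - _ = kappa ^+ 2 * dot (\row_j phi j) (\row_j phi j)); last by ring.
  rewrite ler_pdivlMr ?mulr_gt0//.
  have -> : dot (\row_j phi j) (\row_j phi j) = \sum_i v i.
    by apply: eq_bigr => i _; rewrite mxE -expr2 phi2.
  have : \sum_i v i <= n%:R.
    rewrite -[leRHS]mulr1 mulr_natl -[n in X in _ <= X](card_ord n) -sumr_const.
    by apply: ler_sum => i _; case/andP: (v01 i).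
  set V := \sum_i v i => Vn.
  rewrite -(ler_pM2r nR) -kappaE.
  rewrite (_ : _ * _ * _ * _ = kappa ^+ 2 * mu ^+ 2 * n%:R ^+ 2 * V); last by ring.
  rewrite (_ : _ * _ * n%:R = kappa ^+ 2 * mu ^+ 2 * n%:R ^+ 2 * n%:R); last by ring.
  by apply: ler_wpM2l => //; apply: mulr_ge0; [apply: mulr_ge0|]; exact: sqr_ge0.
- exact: he.
Qed.
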